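(* Let $n,m\ge1$ be integers, $\Phi\in\mathcal{C}$, $K\in\mathcal{K}_{(o)}^{n,1}$ and $A\in SL(n)$. Then $$\Pi_\Phi^m(AK)=A^{-\mathrm T}\,\Pi_\Phi^mK .$$
   Context: $M_{n,m}(\mathbb{R})$ is the space of real $n\times m$ matrices with inner product $\pmb{x}\cdot\pmb{y}=\mathrm{tr}(\pmb{x}^{\mathrm T}\pmb{y})$, identified with $\mathbb{R}^{nm}$; $M_{n,1}(\mathbb{R})=\mathbb{R}^n$ (columns), and $M_{1,m}(\mathbb{R})$ consists of row vectors. $V_n$ is the volume on $M_{n,1}(\mathbb{R})$. $SL(n)$ is the group of real $n\times n$ matrices of determinant $1$, and $A^{-\mathrm T}=(A^{\mathrm T})^{-1}$. For an $n\times n$ matrix $B$ and $E\subset M_{n,m}(\mathbb{R})$, $BE=\{B\pmb{y}:\pmb{y}\in E\}$ (matrix product, i.e. $B$ acts on each column). A convex body is a compact convex set with nonempty interior; $\mathcal{K}_{(o)}^{n,m}$ is the set of convex bodies in $M_{n,m}(\mathbb{R})$ containing the origin $o$ in their interior. $S^{n-1}$ is the Euclidean unit sphere of $M_{n,1}(\mathbb{R})$. The support function is $h_K(\pmb{x})=\max\{\pmb{x}\cdot\pmb{y}:\pmb{y}\in K\}$, and $S_K$ is the surface area measure of $K\in\mathcal{K}_{(o)}^{n,1}$ on $S^{n-1}$ (the $\mathcal{H}^{n-1}$-measure of the set of boundary points having an outer unit normal in the given Borel set). $\mathcal{C}$ is the set of convex functions $\Phi:M_{1,m}(\mathbb{R})\to[0,\infty)$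 with $\Phi(o)=0$ and $\Phi(z)+\Phi(-z)>0$ for all $z\neq o$. For $\Phi\in\mathcal{C}$ and $K\in\mathcal{K}_{(o)}^{n,1}$, the $m$th order Orlicz projection body $\Pi_\Phi^mK\in\mathcal{K}_{(o)}^{n,m}$ is the convex body in $M_{n,m}(\mathbb{R})$ whose support function is $h_{\Pi_\Phi^mK}(o)=0$ and, for $\pmb{x}\neq o$, $$h_{\Pi_\Phi^mK}(\pmb{x})=\inf\Big\{\tfrac1t>0:\int_{S^{n-1}}\Phi\Big(t\,\frac{u^{\mathrm T}\pmb{x}}{h_K(u)}\Big)h_K(u)\,dS_K(u)\le nV_n(K)\Big\},$$ where $u^{\mathrm T}\pmb{x}\in M_{1,m}(\mathbb{R})$ is the matrix product. *)

(* Defs.v *)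
From HB Require Import structures.
From mathcomp Require Import all_boot all_order all_algebra.
From mathcomp Require Import all_classical all_reals all_analysis.

Set Implicit Arguments.
Unset Strict Implicit.
Unset Printing Implicit Defensive.

Import Order.TTheory GRing.Theory Num.Theory.
Import numFieldNormedType.Exports.

Local Open Scope classical_set_scope.
Local Open Scope ring_scope.

(* The norm that the library puts on matrices is the sup norm: it is used here
   only through the topology it induces. Lengths are Euclidean, [mxenorm]. *)
Definition mxdot (R : realType) (n m : nat) (x y : 'M[R]_(n, m)) : R :=
  \tr (x^T *m y).

Definition mxenorm (R : realType) (n m : nat) (x : 'M[R]_(n, m)) : R :=
  Num.sqrt (mxdot x x).

Definition unit_ball (R : realType) (n : nat) : set 'cV[R]_n :=
  [set x | mxenorm x <= 1].

Definition unit_sphere (R : realType) (n : nat) : set 'cV[R]_n :=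
  [set x | mxenorm x = 1].

Definition mximage (R : realType) (n m : nat) (B : 'M[R]_n)
    (E : set 'M[R]_(n, m)) : set 'M[R]_(n, m) :=
  [set B *m y | y in E].

Definition convex_body (R : realType) (n m : nat) (K : set 'M[R]_(n, m)) :
    Prop :=
  [/\ compact K, convex_set K & K° !=set0].

Definition convex_body_o (R : realType) (n m : nat) (K : set 'M[R]_(n, m)) :
    Prop :=
  convex_body K /\ K° 0.

Definition support_function (R : realType) (n m : nat) (K : set 'M[R]_(n, m))
    (x : 'M[R]_(n, m)) : R :=
  sup [set mxdot x y | y in K].

(* n-dimensional Lebesgue measure, as the iterated product of the Lebesgue
   measure on the line (compare [product_measure1]); on a Borel set this is
   its volume. A point of R^(n+1) is split as its first coordinate [x] and the
   column [v] of the other ones, and R^0 has volume 1. *)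
Fixpoint volume (R : realType) (n : nat) : set 'cV[R]_n -> \bar R :=
  match n return set 'cV[R]_n -> \bar R with
  | 0 => fun E => (\1_E (0 : 'cV[R]_0))%:E
  | n'.+1 => fun E =>
      (\int[@lebesgue_measure R]_x
         volume [set v : 'cV[R]_n' | E (col_mx (x%:M : 'cV[R]_1) v)])%E
  end.

Definition diameter (R : realType) (n : nat) (E : set 'cV[R]_n) : R :=
  sup [set r | exists x y, [/\ E x, E y & r = mxenorm (x - y)]].

(* The volume of a d-dimensional Euclidean ball of diameter [diameter E].
   The empty set is singled out because r ^+ 0 = 1 also for r = 0. *)
Definition hausdorff_weight (R : realType) (d n : nat) (E : set 'cV[R]_n) :
    \bar R :=
  (if E == set0 then 0
   else ((diameter E / 2) ^+ d)%:E * volume (@unit_ball R d))%E.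

Definition hausdorff_cover (R : realType) (n : nat) (delta : R)
    (E : set 'cV[R]_n) : set (nat -> set 'cV[R]_n) :=
  [set F | E `<=` \bigcup_k F k /\
           forall k x y, F k x -> F k y -> mxenorm (x - y) <= delta].

Definition hausdorff_content (R : realType) (d n : nat) (delta : R)
    (E : set 'cV[R]_n) : \bar R :=
  ereal_inf [set (\sum_(k <oo) hausdorff_weight d (F k))%E
            | F in hausdorff_cover delta E].

(* d-dimensional Hausdorff (outer) measure in R^n, normalised so as to agree
   with Lebesgue measure when d = n. *)
Definition hausdorff_measure (R : realType) (d n : nat) (E : set 'cV[R]_n) :
    \bar R :=
  ereal_sup [set hausdorff_content d delta E | delta in [set r : R | 0 < r]].

Definition outer_unit_normal (R : realType) (n : nat) (K : set 'cV[R]_n)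
    (y u : 'cV[R]_n) : Prop :=
  unit_sphere u /\ forall z, K z -> mxdot z u <= mxdot y u.

Definition borel_cV (R : realType) (n : nat) :=
  g_sigma_algebraType (@open 'cV[R]_n).

(* Carried by the unit sphere, and defined on all subsets of R^n so that it
   can be used with the library integral over the sphere. *)
Definition surface_area_measure (R : realType) (n : nat) (K : set 'cV[R]_n)
    (W : set (borel_cV R n)) : \bar R :=
  hausdorff_measure n.-1
    [set y | (closure K `\` K°) y /\
             exists2 u, W u & outer_unit_normal K y u].

Definition orlicz_class (R : realType) (m : nat) (Phi : 'rV[R]_m -> R) :
    Prop :=
  [/\ convex_function setT Phi,
      forall z, 0 <= Phi z,
      Phi 0 = 0
    & forall z, z != 0 -> 0 < Phi z + Phi (- z)].

Definition orlicz_integral (R : realType) (n m : nat) (Phi : 'rV[R]_m -> R)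
    (K : set 'cV[R]_n) (x : 'M[R]_(n, m)) (t : R) : \bar R :=
  (\int[surface_area_measure K]_(u in (@unit_sphere R n : set (borel_cV R n)))
     (Phi ((t / support_function K u) *: ((u : 'cV[R]_n)^T *m x))
      * support_function K u)%:E)%E.

Definition orlicz_projection_support (R : realType) (n m : nat)
    (Phi : 'rV[R]_m -> R) (K : set 'cV[R]_n) (x : 'M[R]_(n, m)) : R :=
  if x == 0 then 0
  else inf [set t^-1 | t in
         [set t | 0 < t /\
                  (orlicz_integral Phi K x t <= n%:R%:E * volume K)%E]].

(* "The" convex body with the given support function, by definite
   description: a convex body is determined by its support function. *)
Definition orlicz_projection_body (R : realType) (n m : nat)
    (Phi : 'rV[R]_m -> R) (K : set 'cV[R]_n) : set 'M[R]_(n, m) :=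
  xget set0 [set P : set 'M[R]_(n, m) |
    convex_body_o P /\
    forall x, support_function P x = orlicz_projection_support Phi K x].

(* Main.v *)
(* Write S_K for the surface area measure. A linear map A with det A = 1 sends a
   boundary point of K with outer normal u to one of AK with outer normal
   u' = A^-T u / |A^-T u|, and h_AK(u') = h_K(u) / |A^-T u|. Both defining
   integrals agree, at x for AK and at A^-1 x for K, as soon as S_AK is the image
   under u |-> u' of the measure |A^-T u| dS_K(u).

   This change of variables needs no regularity of the boundary, not even that S_K
   is additive. Two boundary points y, z with outer normals within eta of v satisfy
   |v . (y - z)| <= eta |y - z|, so a patch of such points projects to the
   hyperplane orthogonal to v by a map that is (1 - eta)^-1-bi-Lipschitz, and its
   Hausdorff measure is multiplied by |A^-T v| under A, up to a factor tending to 1.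
   On the hyperplane the Hausdorff measure is a multiple of Lebesgue measure, as a
   translation invariant Borel measure, and so it scales by the determinant.
   The library integral being a supremum over simple functions, these estimates on
   patches, monotonicity and subadditivity suffice to compare the two integrals.

   No existence theorem for the Orlicz projection body enters: P has the support
   function required for K if and only if A^-T P has the one required for AK, and a
   convex body is determined by its support function. *)

(* A boundary point with several outer normals is counted for disjoint sets of directions, so
   additivity of [surface_area_measure] is not immediate. Every estimate is therefore one-sided,
   with the sharp factor [|A^-T v|], and equality is recovered only at the end, by applying the same
   inequality to [A^-1] and [AK].

   A projected patch is not known to be Borel, while uniqueness of translation invariant measures
   concerns Borel sets; Borel regularity of Hausdorff measure bridges this gap for the single bound
   in use. That Hausdorff measure is a sigma-finite Borel measure comes from Caratheodory's
   criterion for half-spaces and from its finiteness on cubes. Its ratio to Lebesgue measure is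
   never computed: the identities stay in product form and only the volume of a cube is cancelled.

   Two errors arise on a patch, its deviation from a hyperplane and the variation of [|A^-T u|] over
   it. Both are controlled by [eta] and absorbed into a factor [r < 1] on the lower sums, with [r]
   arbitrary. *)
From HB Require Import structures.
Require Import Defs.
From mathcomp Require Import all_boot all_order all_algebra.
From mathcomp Require Import all_classical all_reals all_analysis.
From mathcomp Require Import measurable_realfun zify ring lra.

Set Implicit Arguments.
Unset Strict Implicit.
Unset Printing Implicit Defensive.

Import Order.TTheory GRing.Theory Num.Theory.
Import numFieldNormedType.Exports.

Local Open Scope classical_set_scope.
Local Open Scope ring_scope.

(** * Euclidean geometry of matrices *)

Section euclidean.
Context {R : realType}.

Section matrices.
Context {n m : nat}.
Implicit Types (x y z : 'M[R]_(n, m)) (a : R).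

Lemma mxdotE x y : mxdot x y = \sum_i \sum_j x i j * y i j.
Proof.
rewrite /mxdot /mxtrace exchange_big; apply: eq_bigr => j _ /=.
by rewrite mxE; apply: eq_bigr => i _; rewrite mxE.
Qed.

Lemma mxdotC x y : mxdot x y = mxdot y x.
Proof. by rewrite !mxdotE; do 2 (apply: eq_bigr => ? _); rewrite mulrC. Qed.

Lemma mxdotDr x y z : mxdot x (y + z) = mxdot x y + mxdot x z.
Proof. by rewrite /mxdot mulmxDr raddfD. Qed.

Lemma mxdotZr a x y : mxdot x (a *: y) = a * mxdot x y.
Proof. by rewrite /mxdot -scalemxAr linearZ. Qed.

Lemma mxdotNr x y : mxdot x (- y) = - mxdot x y.
Proof. by rewrite -scaleN1r mxdotZr mulN1r. Qed.

Lemma mxdotBr x y z : mxdot x (y - z) = mxdot x y - mxdot x z.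
Proof. by rewrite mxdotDr mxdotNr. Qed.

Lemma mxdotDl x y z : mxdot (x + y) z = mxdot x z + mxdot y z.
Proof. by rewrite mxdotC mxdotDr !(mxdotC z). Qed.

Lemma mxdotZl a x y : mxdot (a *: x) y = a * mxdot x y.
Proof. by rewrite mxdotC mxdotZr mxdotC. Qed.

Lemma mxdotNl x y : mxdot (- x) y = - mxdot x y.
Proof. by rewrite mxdotC mxdotNr mxdotC. Qed.

Lemma mxdotBl x y z : mxdot (x - y) z = mxdot x z - mxdot y z.
Proof. by rewrite mxdotDl mxdotNl. Qed.

Lemma mxdot0r x : mxdot x 0 = 0.
Proof. by rewrite -(scale0r 0) mxdotZr mul0r. Qed.

Lemma mxdot0l x : mxdot 0 x = 0.
Proof. by rewrite mxdotC mxdot0r. Qed.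

Lemma mxdot_ge0 x : 0 <= mxdot x x.
Proof. by rewrite mxdotE; do 2 (apply: sumr_ge0 => ? _); rewrite -expr2 sqr_ge0. Qed.

Lemma mxenorm_ge0 x : 0 <= mxenorm x.
Proof. exact: sqrtr_ge0. Qed.

Lemma mxenorm_sqr x : mxenorm x ^+ 2 = mxdot x x.
Proof. by rewrite sqr_sqrtr ?mxdot_ge0. Qed.

Lemma ler_coord_mxenorm x i j : `|x i j| <= mxenorm x.
Proof.
rewrite -sqrtr_sqr ler_wsqrtr// mxdotE (bigD1 i)//= (bigD1 j)//= -expr2.
rewrite -addrA lerDl addr_ge0//.
  by apply: sumr_ge0 => ? _; rewrite -expr2 sqr_ge0.
by do 2 (apply: sumr_ge0 => ? _); rewrite -expr2 sqr_ge0.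
Qed.

Lemma mxenorm_eq0 x : mxenorm x = 0 -> x = 0.
Proof.
move=> x0; apply/matrixP => i j; rewrite mxE.
by apply/eqP; rewrite -normr_le0 -x0 ler_coord_mxenorm.
Qed.

Lemma mxenorm_gt0 x : (0 < mxenorm x) = (x != 0).
Proof.
apply/idP/idP => [|x0].
  by apply: contraTneq => ->; rewrite /mxenorm mxdot0r sqrtr0 ltxx.
by rewrite lt_def mxenorm_ge0 andbT; apply: contra_neq x0; apply: mxenorm_eq0.
Qed.

Lemma mxenormZ a x : mxenorm (a *: x) = `|a| * mxenorm x.
Proof.
by rewrite /mxenorm mxdotZr mxdotZl mulrA -expr2 sqrtrM ?sqr_ge0// sqrtr_sqr.
Qed.

Lemma mxenormN x : mxenorm (- x) = mxenorm x.
Proof. by rewrite -scaleN1r mxenormZ normrN1 mul1r. Qed.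

Lemma mxenormB x y : mxenorm (x - y) = mxenorm (y - x).
Proof. by rewrite -mxenormN opprB. Qed.

Lemma mxenorm0 : mxenorm (0 : 'M[R]_(n, m)) = 0.
Proof. by rewrite /mxenorm mxdot0r sqrtr0. Qed.

Lemma cauchy_schwarz_mxdot x y : mxdot x y <= mxenorm x * mxenorm y.
Proof.
have [->|] := eqVneq x 0; first by rewrite mxdot0l mxenorm0 mul0r.
have [->|] := eqVneq y 0; first by rewrite mxdot0r mxenorm0 mulr0.
rewrite -!mxenorm_gt0 => y0 x0.
(* The square expands to [2 |x| |y| (|x| |y| - x . y)], and the first factor is positive. *)
have := mxdot_ge0 (mxenorm y *: x - mxenorm x *: y).
rewrite !(mxdotBr, mxdotBl, mxdotZr, mxdotZl) -!mxenorm_sqr (mxdotC y x).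
have xy0 : 0 < mxenorm x * mxenorm y by rewrite mulr_gt0.
move=> h; rewrite -subr_ge0 -(pmulr_rge0 _ xy0).
by move: h; rewrite -(pmulr_rge0 _ (ltr0Sn R 1)) => h; nra.
Qed.

Lemma abs_mxdot_le x y : `|mxdot x y| <= mxenorm x * mxenorm y.
Proof.
rewrite ler_norml cauchy_schwarz_mxdot andbT lerNl -mxdotNl.
by rewrite (le_trans (cauchy_schwarz_mxdot _ _))// mxenormN.
Qed.

Lemma mxenormD x y : mxenorm (x + y) <= mxenorm x + mxenorm y.
Proof.
have := cauchy_schwarz_mxdot x y => xy.
rewrite -(@ler_pXn2r _ 2) ?nnegrE ?addr_ge0 ?mxenorm_ge0//.
rewrite sqrrD !mxenorm_sqr mxdotDr !mxdotDl (mxdotC y x).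
lra.
Qed.

Lemma mxenorm_le_sum x : mxenorm x <= \sum_i \sum_j `|x i j|.
Proof.
have S0 : 0 <= \sum_i \sum_j `|x i j| by do 2 (apply: sumr_ge0 => ? _).
rewrite -[leRHS](ger0_norm S0) -sqrtr_sqr ler_wsqrtr// mxdotE expr2.
rewrite [leRHS]mulr_suml; apply: ler_sum => i _.
rewrite [leRHS]mulr_suml; apply: ler_sum => j _.
rewrite (le_trans (ler_norm _))// normrM ler_wpM2l//.
rewrite (bigD1 i)//= (bigD1 j)//= -addrA lerDl addr_ge0//.
  exact: sumr_ge0.
by do 2 (apply: sumr_ge0 => ? _).
Qed.

End matrices.

Lemma mxdot_mulmxl n p m (A : 'M[R]_(n, p)) (x : 'M[R]_(p, m)) y :
  mxdot (A *m x) y = mxdot x (A^T *m y).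
Proof. by rewrite /mxdot trmx_mul mulmxA. Qed.

Lemma mxdot_mulmxr n p m (A : 'M[R]_(n, p)) (x : 'M[R]_(p, m)) y :
  mxdot y (A *m x) = mxdot (A^T *m y) x.
Proof. by rewrite mxdotC mxdot_mulmxl mxdotC. Qed.

(** [mxenorm A] is the Frobenius norm of [A]; Cauchy-Schwarz is applied to each row. *)
Lemma mxenorm_mulmx n p (A : 'M[R]_(n, p)) (x : 'cV[R]_p) :
  mxenorm (A *m x) <= mxenorm A * mxenorm x.
Proof.
have cE (y : 'cV[R]_p) (z : 'cV[R]_p) : mxdot y z = \sum_i y i 0 * z i 0.
  by rewrite mxdotE; apply: eq_bigr => i _; rewrite big_ord1.
rewrite -(@ler_pXn2r _ 2) ?nnegrE ?mulr_ge0 ?mxenorm_ge0//.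
rewrite exprMn !mxenorm_sqr !mxdotE mulr_suml; apply: ler_sum => i _.
rewrite big_ord1 -expr2.
have -> : (A *m x) i 0 = mxdot (row i A)^T x.
  by rewrite mxE cE; apply: eq_bigr => j _; rewrite !mxE.
have -> : \sum_j A i j * A i j = mxdot (row i A)^T (row i A)^T.
  by rewrite cE; apply: eq_bigr => j _; rewrite !mxE.
have -> : \sum_j \sum_k x j k * x j k = mxdot x x by rewrite mxdotE.
rewrite -!mxenorm_sqr -exprMn -[leLHS]real_normK ?num_real//.
by rewrite ler_pXn2r ?nnegrE ?mulr_ge0 ?mxenorm_ge0// abs_mxdot_le.
Qed.

Lemma mxenorm_orthogonal n p (A : 'M[R]_(n, p)) (x : 'cV[R]_p) :
  A^T *m A = 1%:M -> mxenorm (A *m x) = mxenorm x.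
Proof. by move=> AA; rewrite /mxenorm mxdot_mulmxl mulmxA AA mul1mx. Qed.

Lemma mxdot_col_mx n (a b : 'cV[R]_1) (x y : 'cV[R]_n) :
  mxdot (col_mx a x) (col_mx b y) = a 0 0 * b 0 0 + mxdot x y.
Proof.
rewrite /mxdot tr_col_mx mul_row_col raddfD/=; congr (_ + _).
by rewrite /mxtrace big_ord1 !mxE big_ord1 !mxE.
Qed.

Lemma first_coord_mxdot n (x : 'cV[R]_(1 + n)) : mxdot (col_mx 1 0) x = x 0 0.
Proof.
rewrite -[x in LHS]vsubmxK mxdot_col_mx mxdot0l addr0 !mxE mul1r.
by congr (x _ _); exact/val_inj.
Qed.

(** An orthogonal change of basis brings a matrix to this shape; the determinant then factors, and
    the lower block acts in one dimension less. *)
Lemma block_of_first_row d (M : 'M[R]_(1 + d)) (a : R) :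
  row 0 M = a *: (col_mx 1 0)^T ->
  exists b D, M = block_mx (a%:M : 'M[R]_1) 0 b D.
Proof.
move=> rM; have M0 k : M 0 k = a * (col_mx 1 0 : 'cV[R]_(1 + d)) k 0.
  by move/rowP/(_ k): rM; rewrite mxE [RHS]mxE [X in _ * X]mxE.
have e0 : lshift d (0 : 'I_1) = 0 by exact/val_inj.
exists (dlsubmx M), (drsubmx M); rewrite -[LHS]submxK; congr block_mx.
  apply/matrixP => i j; rewrite !ord1 [LHS]mxE [LHS]mxE [RHS]mxE eqxx mulr1n.
  by rewrite e0 M0 -[X in _ * col_mx _ _ X _]e0 col_mxEu mxE mulr1.
apply/matrixP => i j; rewrite ord1 [LHS]mxE [LHS]mxE mxE.
by rewrite e0 M0 col_mxEd mxE mulr0.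
Qed.

Lemma norm_det_orthogonal n (Q : 'M[R]_n) : Q^T *m Q = 1%:M -> `|\det Q| = 1.
Proof.
move=> QQ; apply/eqP; rewrite -(@eqrXn2 _ 2)//.
by rewrite expr1n real_normK ?num_real// expr2 -{1}det_tr -det_mulmx QQ det1.
Qed.

(* The orthogonal matrix is the reflection exchanging [v] and [e_1]. *)
Lemma orthogonal_to_first n (v : 'cV[R]_(1 + n)) : mxenorm v = 1 ->
  exists2 O : 'M[R]_(1 + n), O^T *m O = 1%:M & O *m v = col_mx 1 0.
Proof.
move=> v1; pose e : 'cV[R]_(1 + n) := col_mx 1 0.
have ee : mxdot e e = 1 by rewrite mxdot_col_mx mxdot0r addr0 !mxE mulr1.
have vv : mxdot v v = 1 by rewrite -mxenorm_sqr v1 expr1n.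
have [->|ve] := eqVneq v e.
  by exists 1%:M; rewrite ?trmx1 mul1mx.
have [w wE] : exists w, w = v - e by exists (v - e).
pose c := 2 / mxdot w w.
have ww0 : mxdot w w != 0.
  by rewrite -mxenorm_sqr expf_neq0// gt_eqF// mxenorm_gt0 wE subr_eq0.
have scal (x y z : 'cV[R]_(1 + n)) : x *m y^T *m z = mxdot y z *: x.
  by rewrite -mulmxA [y^T *m z]mx11_scalar mul_mx_scalar /mxdot /mxtrace big_ord1.
have OT : (1%:M - c *: (w *m w^T))^T = 1%:M - c *: (w *m w^T).
  by rewrite linearB/= linearZ/= trmx1 trmx_mul trmxK.
exists (1%:M - c *: (w *m w^T)).
  rewrite OT mulmxBr mulmx1 mulmxBl mul1mx -!scalemxAl -!scalemxAr mulmxA scal.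
  rewrite -!scalemxAl !scalerA.
  have -> : c * (c * mxdot w w) = c *+ 2.
    by rewrite /c divfK// mulr_natr.
  by rewrite mulr2n scalerDl; apply/matrixP => i j; rewrite !mxE; ring.
rewrite mulmxBl mul1mx -scalemxAl scal scalerA.
(* Both vectors are unit, so [w . w = 2 - 2 e . v = 2 w . v]: the reflection subtracts exactly [w]
   from [v]. *)
have -> : c * mxdot w v = 1.
  rewrite /c mulrAC -[RHS](divff ww0); congr (_ / _).
  rewrite wE !(mxdotBl, mxdotBr) ee vv (mxdotC v e); ring.
by rewrite scale1r wE opprB addrC subrK.
Qed.

End euclidean.

(** * Borel measurability by coordinates *)

Section borel.
Context {R : realType}.

Lemma open_borel n (U : set 'cV[R]_n) : open U -> measurable (U : set (borel_cV R n)).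
Proof. exact: sub_sigma_algebra. Qed.

Lemma closed_borel n (U : set 'cV[R]_n) :
  closed U -> measurable (U : set (borel_cV R n)).
Proof.
by move=> cU; rewrite -[U]setCK; apply: measurableC; apply: open_borel; rewrite openC.
Qed.

Lemma continuous_measurable_borel n (f : 'cV[R]_n -> R) :
  continuous f -> measurable_fun setT (f : borel_cV R n -> R).
Proof.
move=> /continuousP cf; apply: (measurability _ (RGenOpens.measurableE R)).
move=> _ [_ [a [b ->] <-]]; rewrite setTI; apply: open_borel.
exact/cf/interval_open.
Qed.

Lemma measurable_coord n (i : 'I_n) :
  measurable_fun setT (fun v : borel_cV R n => (v : 'cV[R]_n) i 0).
Proof. by apply: continuous_measurable_borel; exact: coord_continuous. Qed.

Let box n (q : 'cV[rat]_n * nat) : set 'cV[R]_n :=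
  [set v | forall i, `|v i 0 - ratr (q.1 i 0)| < q.2.+1%:R^-1].

Let open_bigcup_box n (U : set 'cV[R]_n) : open U ->
  U = \bigcup_(q in [set q | box q `<=` U]) box q.
Proof.
move=> oU; apply/seteqP; split=> [v Uv|v [q /= qU /qU//]].
have [e /= e0 eU] : nbhs_ball v U by apply/nbhs_ballP; exact: open_nbhs_nbhs.
(* Half of [e], because [v] and [w] are each compared with the rational centre of the box. *)
have [k ke] : exists k : nat, k.+1%:R^-1 < e / 2.
  have := near_infty_natSinv_lt (PosNum (divr_gt0 e0 (ltr0Sn R 1))).
  by case=> k _ /(_ k (leqnn k)) ?; exists k.
have k0 : 0 < k.+1%:R^-1 :> R by [].
have [r rE] : exists r : R, r = k.+1%:R^-1 by exists k.+1%:R^-1.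
rewrite -rE in ke k0.
have /choice[q qP] (i : 'I_n) :
    exists q : rat, `|v i 0 - ratr q| < r.
  have /rat_in_itvoo[q] : v i 0 - r < v i 0 + r by lra.
  by rewrite in_itv/= => /andP[q1 q2]; exists q; rewrite ltr_norml; lra.
exists (\col_i q i, k) => /=; last by move=> i; rewrite mxE -rE.
move=> w wq; apply: eU; split=> // i j; rewrite ord1 /ball/=.
have := wq i; have := qP i; rewrite mxE /= -rE !ltr_norml => /andP[? ?] /andP[? ?].
by lra.
Qed.

(** Each open set is a countable union of rational boxes, and a box is a finite intersection of
    conditions on the coordinates. *)
Lemma measurable_to_borel d (T : measurableType d) n (f : T -> borel_cV R n) :
  (forall i, measurable_fun setT (fun t => (f t : 'cV[R]_n) i 0)) ->
  measurable_fun setT f.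
Proof.
move=> mf; apply: (@measurability _ _ T (borel_cV R n) setT f (@open 'cV[R]_n)) => [//|].
move=> _ [U oU <-]; rewrite setTI (open_bigcup_box oU) preimage_bigcup.
rewrite bigcup_mkcond; apply: countable_bigcupT_measurable => // q.
case: ifPn => _ //.
have -> : f @^-1` box q = \bigcap_(i in [set: 'I_n])
    ((fun t => (f t : 'cV[R]_n) i 0) @^-1`
      `]ratr (q.1 i 0) - q.2.+1%:R^-1, ratr (q.1 i 0) + q.2.+1%:R^-1[).
  apply/seteqP; split=> [t /= h i _|t h i]; have := h i.
    by rewrite /= in_itv/= ltr_norml; move: (q.2.+1%:R^-1 : R) => ?; lra.
  by move=> /(_ I); rewrite /= in_itv/= ltr_norml; move: (q.2.+1%:R^-1 : R) => ?; lra.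
apply: fin_bigcap_measurable => // i _.
by rewrite -[X in measurable X]setTI; apply: mf.
Qed.

Lemma measurable_borelD d (T : measurableType d) n (f g : T -> borel_cV R n) :
  measurable_fun setT f -> measurable_fun setT g ->
  measurable_fun setT
    (fun t => ((f t : 'cV[R]_n) + (g t : 'cV[R]_n)) : borel_cV R n).
Proof.
move=> mf mg; apply: measurable_to_borel => i.
have -> : (fun t => ((f t : 'cV[R]_n) + g t) i 0) =
  (fun t => (f t : 'cV[R]_n) i 0) \+ (fun t => (g t : 'cV[R]_n) i 0).
  by apply/funext => t; rewrite !mxE.
by apply: measurable_funD; apply: (measurableT_comp (measurable_coord i)).
Qed.

Lemma measurable_borel_mulmx d (T : measurableType d) n p (A : 'M[R]_(p, n))
    (f : T -> borel_cV R n) :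
  measurable_fun setT f ->
  measurable_fun setT (fun t => (A *m (f t : 'cV[R]_n)) : borel_cV R p).
Proof.
move=> mf; apply: measurable_to_borel => i.
have -> : (fun t => (A *m (f t : 'cV[R]_n)) i 0) =
  (fun t => \sum_j A i j * (f t : 'cV[R]_n) j 0).
  by apply/funext => t; rewrite !mxE.
apply: measurable_sum => j.
by apply: measurable_funM => //; apply: (measurableT_comp (measurable_coord j)).
Qed.

Lemma measurable_borel_scale d (T : measurableType d) n (g : T -> R)
    (f : T -> borel_cV R n) :
  measurable_fun setT g -> measurable_fun setT f ->
  measurable_fun setT (fun t => (g t *: (f t : 'cV[R]_n)) : borel_cV R n).
Proof.
move=> mg mf; apply: measurable_to_borel => i.
have -> : (fun t => (g t *: (f t : 'cV[R]_n)) i 0) =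
  g \* (fun t => (f t : 'cV[R]_n) i 0).
  by apply/funext => t; rewrite !mxE.
by apply: measurable_funM => //; apply: (measurableT_comp (measurable_coord i)).
Qed.

Lemma measurable_mxenorm n :
  measurable_fun setT (fun v : borel_cV R n => mxenorm (v : 'cV[R]_n)).
Proof.
have -> : (fun v : borel_cV R n => mxenorm (v : 'cV[R]_n)) =
    Num.sqrt \o (fun v : borel_cV R n =>
      \sum_i (v : 'cV[R]_n) i 0 * (v : 'cV[R]_n) i 0).
  apply/funext => v; rewrite /mxenorm mxdotE/=; congr Num.sqrt.
  by apply: eq_bigr => i _; rewrite big_ord1.
apply: measurableT_comp.
  by apply: continuous_measurable_fun; exact: sqrt_continuous.
by apply: measurable_sum => i; apply: measurable_funM; exact: measurable_coord.
Qed.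

Lemma measurable_cons n : measurable_fun setT
  (fun p : measurableTypeR R * borel_cV R n =>
    (col_mx (p.1%:M : 'cV[R]_1) (p.2 : 'cV[R]_n)) : borel_cV R n.+1).
Proof.
apply: measurable_to_borel => i; rewrite -[i]/(i : 'I_(1 + n)).
have [j ->|j ->] := split_ordP (i : 'I_(1 + n)).
  have -> : (fun p : measurableTypeR R * borel_cV R n =>
    (col_mx (p.1%:M : 'cV[R]_1) (p.2 : 'cV[R]_n)) (lshift n j) 0) = fst.
    by apply/funext => p; rewrite (@col_mxEu _ 1) !ord1 mxE eqxx mulr1n.
  exact: measurable_fst.
have -> : (fun p : measurableTypeR R * borel_cV R n =>
    (col_mx (p.1%:M : 'cV[R]_1) (p.2 : 'cV[R]_n)) (rshift 1 j) 0) =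
    (fun v : borel_cV R n => (v : 'cV[R]_n) j 0) \o snd.
  by apply/funext => p /=; rewrite (@col_mxEd _ 1).
apply: measurableT_comp; [exact: measurable_coord|exact: measurable_snd].
Qed.

End borel.

(** * Volume as a measure *)

Section volume_measure.
Context {R : realType}.

Lemma sigma_finite_measure_of_function d (T : measurableType d)
    (mu : set T -> \bar R) :
  mu set0 = 0%E -> (forall A, 0 <= mu A)%E -> semi_sigma_additive mu ->
  sigma_finite setT mu ->
  exists m : {sigma_finite_measure set T -> \bar R}, m = mu :> (set T -> \bar R).
Proof.
move=> mu0 mu_ge0 muU muoo.
pose m1 := isMeasure.Build _ _ _ mu mu0 mu_ge0 muU.
pose M : {measure set T -> \bar R} := HB.pack mu m1.
pose m2 := Measure_isSigmaFinite.Build _ _ _ M muoo.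
pose N : {sigma_finite_measure set T -> \bar R} := HB.pack mu m1 m2.
by exists N.
Qed.

Definition slice n (E : set 'cV[R]_n.+1) (x : R) : set 'cV[R]_n :=
  [set v | E (col_mx (x%:M : 'cV[R]_1) v)].

Lemma volume_slice n (E : set 'cV[R]_n.+1) :
  volume E = (\int[lebesgue_measure]_x volume (slice E x))%E.
Proof. by []. Qed.

Definition cube n (r : R) : set 'cV[R]_n := [set v | forall i, `|v i 0| <= r].

Lemma measurable_cube n r : measurable (@cube n r : set (borel_cV R n)).
Proof.
have -> : @cube n r = \bigcap_(i in [set: 'I_n])
    ((fun v : borel_cV R n => (v : 'cV[R]_n) i 0) @^-1` `[- r, r]).
  apply/seteqP; split=> [v /= h i _|v h i].
    by rewrite /= in_itv/= -ler_norml.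
  by have := h i I; rewrite /= in_itv/= -ler_norml.
apply: fin_bigcap_measurable => // i _.
by rewrite -[X in measurable X]setTI; apply: measurable_coord.
Qed.

Lemma bigcup_cube n : \bigcup_k @cube n k%:R = setT.
Proof.
apply/seteqP; split => // v _; exists (Num.truncn (mxenorm v)).+1 => // i.
by rewrite (le_trans (ler_coord_mxenorm _ _ _))// ltW// truncnS_gt.
Qed.

Lemma volume_set0 n : volume (set0 : set 'cV[R]_n) = 0%E.
Proof.
elim: n => [|n IH]; first by rewrite /= indicE in_set0.
by rewrite volume_slice integral0_eq// => x _; rewrite -[RHS]IH.
Qed.

Lemma volume_cube n (r : R) : 0 <= r ->
  volume (@cube n r) = ((r *+ 2) ^+ n)%:E.
Proof.
move=> r0; elim: n => [|n IH].
  by rewrite /= indicE mem_set// => -[].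
have sE x : slice (@cube n.+1 r) x = if `|x| <= r then @cube n r else set0.
  case: ifPn => xr; apply/seteqP; split => v //=.
  - by move=> h i; have := h (rshift 1 i); rewrite (@col_mxEd _ 1).
  - move=> h i; rewrite -[i]/(i : 'I_(1 + n)).
    have [j ->|j ->] := split_ordP (i : 'I_(1 + n)).
      by rewrite (@col_mxEu _ 1) !ord1 mxE eqxx mulr1n.
    by rewrite (@col_mxEd _ 1).
  - move=> /(_ (lshift n (0 : 'I_1))); rewrite (@col_mxEu _ 1) mxE eqxx mulr1n.
    by rewrite (negbTE xr).
rewrite volume_slice.
transitivity (\int[@lebesgue_measure R]_x
    (cst ((r *+ 2) ^+ n)%R%:E \_ [set` `[(- r)%R, r]]) x)%E.
  apply: eq_integral => x _; rewrite sE patchE/= mem_setE in_itv/= -ler_norml.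
  by case: ifPn => // _; rewrite volume_set0.
rewrite -integral_mkcond integral_cst//= lebesgue_measure_itv/= lte_fin.
rewrite exprSr EFinM; congr (_ * _)%E.
case: ifPn => [_|]; first by rewrite -EFinB opprK mulr2n.
by rewrite -leNgt => h; rewrite (_ : r = 0) ?mul0rn//; lra.
Qed.

(** In dimension n+1, [volume] is the push-forward of a product measure by the map that glues the
    coordinates. Sigma-finiteness is carried through the induction because the product requires
    it. *)
Lemma volume_sigma_finite_measure n :
  exists m : {sigma_finite_measure set (borel_cV R n) -> \bar R},
    m = @volume R n :> (set (borel_cV R n) -> \bar R).
Proof.
elim: n => [|n [mu muE]].
  by exists (@dirac _ (borel_cV R 0) (0 : 'cV[R]_0) R); apply/funext => E.
have [nu nuE] : exists nu : {measure set (borel_cV R n.+1) -> \bar R},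
    nu = @volume R n.+1 :> (set (borel_cV R n.+1) -> \bar R).
  unshelve eexists (pushforward (@lebesgue_measure R \x mu)%E
    (fun p : measurableTypeR R * borel_cV R n =>
    (col_mx (p.1%:M : 'cV[R]_1) (p.2 : 'cV[R]_n)) : borel_cV R n.+1) :
    {measure set (borel_cV R n.+1) -> \bar R}).
    exact: measurable_cons.
  apply/funext => E; rewrite /pushforward /= /product_measure1.
  apply: eq_integral => x _ /=; rewrite muE; congr volume.
  by apply/seteqP; split => v; rewrite /xsection/= inE.
rewrite -nuE; apply: sigma_finite_measure_of_function.
- exact: (measure0 nu).
- exact: (measure_ge0 nu).
- exact: (@measure_semi_sigma_additive _ _ _ nu).
- exists (fun k => @cube n.+1 k%:R); first by rewrite bigcup_cube.
  move=> k; split; first exact: measurable_cube.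
  by rewrite nuE volume_cube// ltry.
Qed.

Definition vol n : {sigma_finite_measure set (borel_cV R n) -> \bar R} :=
  projT1 (cid (volume_sigma_finite_measure n)).

Lemma volE n : vol n = @volume R n :> (set (borel_cV R n) -> \bar R).
Proof. by rewrite /vol; case: cid. Qed.

Lemma lebesgue_measure_shift (a : R) (A : set R) : measurable A ->
  pushforward lebesgue_measure (fun x : measurableTypeR R => x + a : measurableTypeR R) A
  = lebesgue_measure A.
Proof.
move=> mA; apply/esym/lebesgue_measure_unique => //.
  exact: measurable_funD.
move=> mf _ [[b c] _ <-] /=.
rewrite /pushforward [X in _ = lebesgue_measure X](_ : _ = `]b - a, c - a]%classic).
  rewrite !lebesgue_measure_itv/= !lte_fin ltrD2r -!EFinB.
  by rewrite (_ : c - a - (b - a) = c - b)//; ring.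
by apply/seteqP; split => x /=; rewrite !in_itv/= ltrBlDr lerBrDr.
Qed.

Lemma ge0_integral_shift (a : R) (f : R -> \bar R) : measurable_fun setT f ->
  (forall x, 0 <= f x)%E ->
  (\int[lebesgue_measure]_x f (x + a)%R = \int[lebesgue_measure]_x f x)%E.
Proof.
move=> mf f0.
have ms : measurable_fun setT (fun x : measurableTypeR R => x + a : measurableTypeR R).
  by apply: measurable_funD.
rewrite -[LHS](ge0_integral_pushforward ms lebesgue_measure (D := setT))//.
by apply: eq_measure_integral => A mA _; exact: lebesgue_measure_shift.
Qed.

Lemma sliceE n (E : set 'cV[R]_n.+1) : slice E = xsection
    ((fun p : measurableTypeR R * borel_cV R n =>
    (col_mx (p.1%:M : 'cV[R]_1) (p.2 : 'cV[R]_n)) : borel_cV R n.+1) @^-1` E).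
Proof.
by apply/funext => x; apply/seteqP; split => v; rewrite /xsection/= inE.
Qed.

Lemma measurable_slice n (E : set (borel_cV R n.+1)) (x : R) :
  measurable E -> measurable (slice E x : set (borel_cV R n)).
Proof.
move=> mE; rewrite sliceE; apply: measurable_xsection.
by rewrite -[X in measurable X]setTI; apply: measurable_cons.
Qed.

Lemma measurable_volume_slice n (E : set (borel_cV R n.+1)) :
  measurable E -> measurable_fun setT (fun x => volume (slice E x)).
Proof.
move=> mE; rewrite -volE sliceE; apply: measurable_fun_xsection.
by rewrite -[X in measurable X]setTI; apply: measurable_cons.
Qed.

Lemma volume_ge0 n (E : set 'cV[R]_n) : (0 <= volume E)%E.
Proof. by rewrite -(volE n) measure_ge0. Qed.

Lemma scalar_split n (a : 'cV[R]_n.+1) :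
  a = col_mx ((a 0 0)%:M : 'cV[R]_1) (dsubmx (a : 'cV[R]_(1 + n))).
Proof.
have -> : (a 0 0)%:M = usubmx (a : 'cV[R]_(1 + n)) :> 'cV[R]_1.
  apply/matrixP => i j; rewrite !ord1 !mxE eqxx mulr1n; congr (a _ _).
  exact/val_inj.
by rewrite vsubmxK.
Qed.

Lemma col_mx_add n (x : R) (v : 'cV[R]_n) (a : 'cV[R]_n.+1) :
  (col_mx (x%:M : 'cV[R]_1) v : 'cV[R]_n.+1) + a =
  col_mx ((x + a 0 0)%:M : 'cV[R]_1) (v + dsubmx (a : 'cV[R]_(1 + n))).
Proof.
rewrite {1}[a]scalar_split.
by rewrite [LHS](@add_col_mx _ 1 n 1 x%:M v) -raddfD.
Qed.

Lemma measurable_translate n (E : set (borel_cV R n)) (a : 'cV[R]_n) :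
  measurable E -> measurable ([set v | E (v + a)] : set (borel_cV R n)).
Proof.
move=> mE; rewrite -[X in measurable X]setTI.
by apply: (@measurable_borelD R _ (borel_cV R n) n id (cst (a : borel_cV R n))).
Qed.

Lemma volume_translate n (E : set (borel_cV R n)) (a : 'cV[R]_n) :
  measurable E -> volume [set v | E (v + a)] = volume E.
Proof.
elim: n E a => [|n IH] E a mE.
  by congr volume; apply/seteqP; split => v /=; rewrite [a]flatmx0 addr0.
rewrite !volume_slice -[RHS](ge0_integral_shift (a 0 0)); last 2 first.
- exact: measurable_volume_slice.
- by move=> x; exact: volume_ge0.
apply: eq_integral => x _; rewrite -[RHS](IH _ (dsubmx (a : 'cV[R]_(1 + n)))).
  by congr volume; apply/seteqP; split => v /=; rewrite /slice/= col_mx_add.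
exact: measurable_slice.
Qed.

End volume_measure.

(** * Volume and linear maps *)

Section linear_volume.
Context {R : realType}.

Lemma tonelli_sections d1 d2 (T1 : measurableType d1) (T2 : measurableType d2)
    (m1 : {sigma_finite_measure set T1 -> \bar R})
    (m2 : {sigma_finite_measure set T2 -> \bar R}) (A : set (T1 * T2)) :
  measurable A ->
  (\int[m1]_x m2 (xsection A x) = \int[m2]_y m1 (ysection A y))%E.
Proof.
move=> mA; have := indic_fubini_tonelli m1 m2 mA.
by rewrite indic_fubini_tonelli_FE// indic_fubini_tonelli_GE.
Qed.

Lemma integral_if_cst d (T : measurableType d) (m : {measure set T -> \bar R})
    (E : set T) (c : \bar R) (f : T -> \bar R) :
  measurable E -> (0 <= c)%E ->
  (forall x, E x -> f x = c) -> (forall x, ~ E x -> f x = 0%E) ->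
  (\int[m]_x f x = c * m E)%E.
Proof.
move=> mE c0 fE f0; rewrite -integral_cst//.
rewrite [RHS]integral_mkcond; apply: eq_integral => x _.
rewrite patchE; case: ifPn => [/[!inE]/fE//|/negP xE].
by rewrite f0// => /mem_set.
Qed.

(* Integrate the indicator of [{(x, y) | E x, Q (y - x)}] in both orders, and
   use the invariance of [mu] and [nu] to substitute [x + y] for [x]. *)
Lemma translation_invariant_unique n
    (mu nu : {sigma_finite_measure set (borel_cV R n) -> \bar R}) :
  (forall (E : set (borel_cV R n)) (a : 'cV[R]_n), measurable E ->
    mu [set v | E ((v : 'cV[R]_n) + a)] = mu E) ->
  (forall (E : set (borel_cV R n)) (a : 'cV[R]_n), measurable E ->
    nu [set v | E ((v : 'cV[R]_n) + a)] = nu E) ->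
  forall E Q : set (borel_cV R n), measurable E -> measurable Q ->
  (mu E * nu Q = nu E * mu [set v | Q (- (v : 'cV[R]_n))%R])%E.
Proof.
move=> muD nuD E Q mE mQ.
have mN (f : borel_cV R n * borel_cV R n -> borel_cV R n) :
    measurable_fun setT f ->
    measurable_fun setT (fun p => - (f p : 'cV[R]_n) : borel_cV R n).
  move=> mf; have := measurable_borel_mulmx (- 1%:M) mf.
  by under eq_fun do rewrite mulNmx mul1mx.
have mp (f : borel_cV R n * borel_cV R n -> borel_cV R n) (F : set (borel_cV R n)) :
    measurable_fun setT f -> measurable F -> measurable (f @^-1` F).
  by move=> mf mF; rewrite -[X in measurable X]setTI; apply: mf.
pose S : set (borel_cV R n * borel_cV R n) :=
  [set p | E p.1 /\ Q ((p.2 : 'cV[R]_n) - (p.1 : 'cV[R]_n))].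
pose S' : set (borel_cV R n * borel_cV R n) :=
  [set p | Q (- (p.1 : 'cV[R]_n)) /\ E ((p.1 : 'cV[R]_n) + (p.2 : 'cV[R]_n))].
have mS : measurable S.
  apply: measurableI; first exact: (mp fst).
  apply: (mp (fun p => (p.2 : 'cV[R]_n) - (p.1 : 'cV[R]_n))) => //.
  by apply: measurable_borelD => //; apply: mN.
have mS' : measurable S'.
  apply: measurableI.
    by apply: (mp (fun p => - (p.1 : 'cV[R]_n))) => //; apply: mN.
  apply: (mp (fun p => (p.1 : 'cV[R]_n) + (p.2 : 'cV[R]_n))) => //.
  exact: measurable_borelD.
have mQN : measurable ([set v | Q (- (v : 'cV[R]_n))] : set (borel_cV R n)).
  have := measurable_borel_mulmx (- 1%:M) (@measurable_id _ (borel_cV R n) setT).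
  move=> /(_ measurableT Q mQ); rewrite setTI; congr measurable.
  by apply/seteqP; split => v /=; rewrite mulNmx mul1mx.
transitivity (\int[mu]_x nu (xsection S x))%E.
  rewrite muleC; apply/esym/integral_if_cst => // x Ex.
    rewrite -[RHS](nuD _ (- x : 'cV[R]_n))//; congr (nu _).
    by apply/seteqP; split => y; rewrite /xsection/= inE; [case|].
  by rewrite (_ : xsection _ _ = set0)// -subset0 => y; rewrite /xsection/= inE => -[].
rewrite tonelli_sections//.
transitivity (\int[nu]_y mu (ysection S' y))%E.
  apply: eq_integral => y _.
  rewrite -[LHS](muD _ (y : 'cV[R]_n)); last exact: measurable_ysection.
  congr (mu _); apply/seteqP; split => x; rewrite /ysection/= !inE /S /S'/=.
    by rewrite opprD addrCA subrr addr0 => -[].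
  by rewrite opprD addrCA subrr addr0 => -[].
rewrite -tonelli_sections//; apply: integral_if_cst => // z Qz.
  rewrite -[RHS](nuD _ (z : 'cV[R]_n))//; congr (nu _).
  by apply/seteqP; split => y; rewrite /xsection/= inE /S'/= addrC => //; case.
by rewrite (_ : xsection _ _ = set0)// -subset0 => y; rewrite /xsection/= inE => -[].
Qed.

(** The exhausting sets are transported as preimages under the left inverse [g], since images under
    [f] need not be measurable. *)
Lemma sigma_finite_pushforward d1 d2 (T1 : measurableType d1)
    (T2 : measurableType d2) (mu : {sigma_finite_measure set T1 -> \bar R})
    (f : T1 -> T2) (g : T2 -> T1) :
  measurable_fun setT f -> measurable_fun setT g -> cancel f g ->
  exists m : {sigma_finite_measure set T2 -> \bar R},
    m = pushforward mu f :> (set T2 -> \bar R).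
Proof.
move=> mf mg fg.
have [nu nuE] : exists nu : {measure set T2 -> \bar R},
    nu = pushforward mu f :> (set T2 -> \bar R).
  by unshelve eexists (pushforward mu f : {measure set T2 -> \bar R}); [exact: mf|].
rewrite -nuE; apply: sigma_finite_measure_of_function.
- exact: (measure0 nu).
- exact: (measure_ge0 nu).
- exact: (@measure_semi_sigma_additive _ _ _ nu).
- have [F TF Foo] := sigma_finiteT mu.
  exists (fun k => g @^-1` F k).
    apply/seteqP; split => // x _.
    have [k _ Fk] : (\bigcup_k F k) (g x) by rewrite -TF.
    by exists k.
  move=> k; have [mF Fk] := Foo k; split.
    by rewrite -[X in measurable X]setTI; apply: mg.
  rewrite nuE /pushforward [X in mu X](_ : _ = F k)//.
  by apply/seteqP; split => x /=; rewrite fg.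
Qed.

Lemma measurable_mulmx_preimage n p (B : 'M[R]_(p, n)) (E : set (borel_cV R p)) :
  measurable E -> measurable ([set v | E (B *m v)] : set (borel_cV R n)).
Proof.
move=> mE; rewrite -[X in measurable X]setTI.
exact: (measurable_borel_mulmx B (@measurable_id _ (borel_cV R n) setT)).
Qed.

Lemma translate_mulmx_preimage
    n (mu : set (borel_cV R n) -> \bar R) (B : 'M[R]_n) (E : set (borel_cV R n))
    (a : 'cV[R]_n) :
  (forall (E : set (borel_cV R n)) (a : 'cV[R]_n), measurable E ->
    mu [set v | E ((v : 'cV[R]_n) + a)] = mu E) ->
  B \in unitmx -> measurable E ->
  mu [set v | E (B *m (v : 'cV[R]_n) + a)] = mu [set v | E (B *m (v : 'cV[R]_n))].
Proof.
move=> muD uB mE; rewrite -[RHS](muD _ (invmx B *m a)).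
  by congr mu; apply/seteqP; split => v /=; rewrite mulmxDr mulKVmx.
exact: measurable_mulmx_preimage.
Qed.

(** This is [translation_invariant_unique] for the push-forward of volume by [B]. The scaling factor
    can then be read off from a single test set [Q] of positive finite volume. *)
Lemma volume_mulmx_preimage_proportional n (B : 'M[R]_n)
    (E Q : set (borel_cV R n)) : B \in unitmx -> measurable E -> measurable Q ->
  (volume [set v | E (B *m v)%R] * volume Q =
   volume E * volume [set v | Q (- (B *m v))%R])%E.
Proof.
move=> uB mE mQ; rewrite -!volE.
have mB (A : 'M[R]_n) : measurable_fun setT
    (fun v : borel_cV R n => A *m (v : 'cV[R]_n) : borel_cV R n).
  exact: (measurable_borel_mulmx A (@measurable_id _ (borel_cV R n) setT)).
have [nu nuE] := sigma_finite_pushforward (vol n) (mB B) (mB (invmx B))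
  (mulKmx uB).
have volD : forall (E : set (borel_cV R n)) (a : 'cV[R]_n), measurable E ->
    vol n [set v | E ((v : 'cV[R]_n) + a)] = vol n E.
  by move=> E' a mE'; rewrite volE volume_translate.
have := @translation_invariant_unique n nu (vol n) _ volD E Q mE mQ.
rewrite nuE /pushforward; apply => F a mF.
exact: (translate_mulmx_preimage a volD uB mF).
Qed.

Lemma cubeN n r (v : 'cV[R]_n) : cube r (- v) = cube r v.
Proof.
by apply/propext; split => h i; have := h i; rewrite mxE normrN.
Qed.

Lemma measurable_unit_ball n : measurable (@unit_ball R n : set (borel_cV R n)).
Proof.
have -> : @unit_ball R n =
    (fun v : borel_cV R n => mxenorm (v : 'cV[R]_n)) @^-1` `]-oo, 1].
  by apply/seteqP; split=> v; rewrite /unit_ball/= in_itv.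
by rewrite -[X in measurable X]setTI; apply: measurable_mxenorm.
Qed.

Lemma volume_unit_ball n :
  exists2 c : R, 0 < c & volume (@unit_ball R n) = c%:E.
Proof.
have mb := @measurable_unit_ball n.
have le1 : (volume (@unit_ball R n) <= ((1 *+ 2) ^+ n)%:E)%E.
  rewrite -(@volume_cube R n _ ler01) -volE; apply: le_measure.
  - by rewrite inE.
  - by rewrite inE; apply: measurable_cube.
  - by move=> v v1 i; rewrite (le_trans (ler_coord_mxenorm _ _ _)).
(* A cube of half-side [1/(n+1)] lies in the ball, as n such coordinates sum to at most 1; the
   successor also covers n = 0. *)
have n0 : 0 < n.+1%:R^-1 :> R by [].
have le2 : (((n.+1%:R^-1 *+ 2) ^+ n)%:E <= volume (@unit_ball R n))%E.
  rewrite -(@volume_cube R n _ (ltW n0)) -volE; apply: le_measure.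
  - by rewrite inE; apply: measurable_cube.
  - by rewrite inE.
  - move=> v vn; apply: (le_trans (mxenorm_le_sum v)).
    apply: (@le_trans _ _ (\sum_(i < n) n.+1%:R^-1)).
      by apply: ler_sum => i _; rewrite big_ord1; exact: vn.
    by rewrite sumr_const card_ord -[_ *+ n]mulr_natl ler_pdivrMr// mul1r ler_nat.
have : volume (@unit_ball R n) \is a fin_num.
  by rewrite ge0_fin_numE ?volume_ge0//; apply: (le_lt_trans le1); rewrite ltry.
move=> /fineK vE; exists (fine (volume (@unit_ball R n))); last by rewrite vE.
by rewrite -lte_fin vE (lt_le_trans _ le2)// lte_fin exprn_gt0.
Qed.

Lemma mule_pfin_inj (c : R) (x y : \bar R) : 0 < c ->
  (x * c%:E = y * c%:E)%E -> x = y.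
Proof.
move=> c0 xy; apply/eqP; rewrite eq_le.
by rewrite -(@lee_pmul2r _ c%:E)// xy lexx -(@lee_pmul2r _ c%:E)// xy lexx.
Qed.

(** The test set is the unit ball, which [B] preserves. *)
Lemma volume_orthogonal_preimage n (B : 'M[R]_n) (E : set (borel_cV R n)) :
  B^T *m B = 1%:M -> measurable E -> volume [set v | E (B *m v)] = volume E.
Proof.
move=> BB mE; have [c c0 cE] := volume_unit_ball n.
have uB : B \in unitmx by case: (mulmx1_unit BB).
have := volume_mulmx_preimage_proportional uB mE (@measurable_unit_ball n).
have -> : [set v | unit_ball (- (B *m v))] = @unit_ball R n.
  by apply/seteqP; split => v; rewrite /unit_ball/= mxenormN mxenorm_orthogonal.
by rewrite cE; apply: mule_pfin_inj.
Qed.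

Lemma volume_mulmx_preimage_of_cube n (B : 'M[R]_n) (c : R) (E : set (borel_cV R n)) :
  B \in unitmx ->
  volume [set v | cube 1 (B *m v)] = (c * (1 *+ 2) ^+ n)%:E ->
  measurable E ->
  volume [set v | E (B *m v)] = (c%:E * volume E)%E.
Proof.
move=> uB cB mE; apply: (@mule_pfin_inj ((1 *+ 2) ^+ n)); first by rewrite exprn_gt0.
have := volume_mulmx_preimage_proportional uB mE (@measurable_cube R n 1).
rewrite volume_cube// => ->.
have -> : [set v | cube 1 (- (B *m v))] = [set v | cube 1 (B *m v)].
  by apply/seteqP; split => v /=; rewrite cubeN.
by rewrite cB EFinM muleCA muleA.
Qed.

(** Induction on the dimension: an orthogonal [Q], harmless for the volume, makes the first row of
    [C = B Q^T] a multiple of that of the identity. The test set is a cube, because its preimage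
    under a block triangular matrix can be sliced explicitly. *)
Lemma volume_mulmx_preimage n (B : 'M[R]_n) (E : set (borel_cV R n)) :
  B \in unitmx -> measurable E ->
  volume [set v | E (B *m v)] = (`|\det B|^-1%:E * volume E)%E.
Proof.
elim: n B E => [|n IH] B E uB mE.
  rewrite det_mx00 normr1 invr1 mul1e; congr volume.
  by apply/seteqP; split => v /=; rewrite (flatmx0 (_ *m _)) (flatmx0 v).
pose r : 'cV[R]_(1 + n) := (row 0 B)^T.
have r0 : r != 0.
  apply/eqP => r0; have : row 0 (B *m invmx B) = 0.
    by rewrite row_mul -[row 0 B]trmxK -/r r0 trmx0 mul0mx.
  by rewrite mulmxV// => /matrixP/(_ 0 0)/eqP; rewrite !mxE eqxx oner_eq0.
have nr0 : 0 < mxenorm r by rewrite mxenorm_gt0.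
have nr1 : mxenorm ((mxenorm r)^-1 *: r) = 1.
  by rewrite mxenormZ normfV ger0_norm ?ltW// mulVf// gt_eqF.
have [Q QQ Qr] := @orthogonal_to_first R n ((mxenorm r)^-1 *: r)
  nr1.
pose C : 'M[R]_(1 + n) := B *m Q^T.
have BC : B = C *m Q by rewrite /C -mulmxA QQ mulmx1.
have uC : C \in unitmx by move: uB; rewrite BC unitmx_mul => /andP[].
have -> : volume [set v | E (B *m v)] = volume [set v | E (C *m v)].
  rewrite BC; under eq_set do rewrite -mulmxA.
  apply: (@volume_orthogonal_preimage _ Q [set v | E (C *m v)]) => //.
  exact: measurable_mulmx_preimage.
rewrite {1}BC det_mulmx normrM (norm_det_orthogonal QQ) mulr1.
have Cr : row 0 C = mxenorm r *: (col_mx 1 0)^T.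
  rewrite /C row_mul -[row 0 B]trmxK -/r -trmx_mul -Qr -scalemxAr.
  by rewrite linearZ/= scalerA divff ?scale1r// gt_eqF.
pose a := mxenorm r; have [b [D CE]] := block_of_first_row Cr.
have detC : \det C = a * \det D by rewrite CE det_lblock det_scalar1.
have : \det C != 0 by rewrite -unitfE -unitmxE.
rewrite detC mulf_eq0 negb_or => /andP[a0 D0].
have uD : D \in unitmx by rewrite unitmxE unitfE.
apply: volume_mulmx_preimage_of_cube => //.
(* The first coordinate of [C (x, v)] is [a x], which restricts [x] to an interval of length
   [2 / |a|]; the other coordinates are [D v + x b], so each slice is a translate composed with [D],
   to which the induction hypothesis applies. *)
have sE x : slice [set v | cube 1 (C *m v)] x =
    if `|x| <= `|a|^-1 then [set v | cube 1 (D *m v + x *: b)] else set0.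
  have Cx v : C *m col_mx (x%:M : 'cV[R]_1) v = col_mx ((a * x)%:M) (D *m v + x *: b).
    rewrite CE mul_block_col mul0mx addr0 -scalar_mxM addrC; congr (col_mx _ (_ + _)).
    by rewrite mul_mx_scalar.
  have ax : (`|x| <= `|a|^-1) = (`|a * x| <= 1).
    by rewrite -[_^-1]mul1r ler_pdivlMr ?normr_gt0// normrM mulrC.
  rewrite ax; case: ifPn => xa; apply/seteqP; split => v //=; rewrite /slice/= Cx.
  - by move=> h i; have := h (rshift 1 i); rewrite (@col_mxEd _ 1).
  - move=> h i; rewrite -[i]/(i : 'I_(1 + n)).
    have [j ->|j ->] := split_ordP (i : 'I_(1 + n)).
      by rewrite (@col_mxEu _ 1) !ord1 mxE eqxx mulr1n.
    by rewrite (@col_mxEd _ 1).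
  - move=> /(_ (lshift n (0 : 'I_1))); rewrite (@col_mxEu _ 1) mxE eqxx mulr1n.
    by rewrite (negbTE xa).
rewrite volume_slice; transitivity ((`|\det D|^-1 * (1 *+ 2) ^+ n)%:E *
    lebesgue_measure [set` `[(- `|a|^-1)%R, (`|a|^-1)%R]])%E; last first.
  rewrite lebesgue_measure_itv/= lte_fin ifT; last first.
    by rewrite gtrN// invr_gt0 normr_gt0.
  rewrite -EFinB -EFinM normrM invfM exprS mulr2n; congr (_%:E); ring.
apply: integral_if_cst => //.
- move=> x /=; rewrite in_itv/= -ler_norml sE => ->.
  rewrite (IH D [set w | cube 1 (w + x *: b)])//.
    by rewrite volume_translate ?volume_cube//; exact: measurable_cube.
  by apply: measurable_translate; exact: measurable_cube.
- move=> x /=; rewrite in_itv/= -ler_norml sE => /negP/negbTE ->.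
  exact: volume_set0.
Qed.

Lemma volume_mximage n (B : 'M[R]_n) (E : set (borel_cV R n)) :
  B \in unitmx -> measurable E ->
  volume (mximage B E) = (`|\det B|%:E * volume E)%E.
Proof.
move=> uB mE; have -> : mximage B E = [set v | E (invmx B *m v)].
  apply/seteqP; split => [_ [v Ev <-] /=|v Ev]; first by rewrite mulKmx.
  by exists (invmx B *m v); rewrite ?mulKVmx.
rewrite volume_mulmx_preimage ?unitmx_inv// det_inv normfV invrK//.
Qed.

End linear_volume.

(** * Hausdorff measure *)

Section hausdorff.
Context {R : realType}.

Section diameter.
Context {n : nat}.
Implicit Types (E : set 'cV[R]_n) (r : R).

Lemma diameter_le E r : 0 <= r ->
  (forall x y, E x -> E y -> mxenorm (x - y) <= r) -> diameter E <= r.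
Proof.
move=> r0 Er; rewrite /diameter; set S := [set _ | _].
have [->|/set0P S0] := eqVneq S set0; first by rewrite sup0.
by apply: ge_sup => // _ [x [y [Ex Ey ->]]]; apply: Er.
Qed.

(** The a priori bound [r] is there because [sup] takes the value 0 on an unbounded set. *)
Lemma diameter_ub E r x y :
  (forall x y, E x -> E y -> mxenorm (x - y) <= r) ->
  E x -> E y -> mxenorm (x - y) <= diameter E.
Proof.
move=> Er Ex Ey; apply: ub_le_sup; last by exists x, y.
by exists r => _ [u [v [Eu Ev ->]]]; apply: Er.
Qed.

Lemma diameter_ge0 E : 0 <= diameter E.
Proof.
rewrite /diameter; set S := [set _ | _].
have [[[r Sr] ubS]|/sup_out->//] := pselect (has_sup S).
apply: le_trans (ub_le_sup ubS Sr); case: Sr => x [y [_ _ ->]].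
exact: mxenorm_ge0.
Qed.

End diameter.

Local Open Scope ereal_scope.

Lemma hausdorff_weight_set0 d n : hausdorff_weight d (set0 : set 'cV[R]_n) = 0.
Proof. by rewrite /hausdorff_weight eqxx. Qed.

Lemma hausdorff_weight_ge0 d n (E : set 'cV[R]_n) : 0 <= hausdorff_weight d E.
Proof.
rewrite /hausdorff_weight; case: ifPn => // _; rewrite mule_ge0 ?volume_ge0//.
by rewrite lee_fin exprn_ge0// divr_ge0// diameter_ge0.
Qed.

(** The condition on nonemptiness matters for d = 0, where every nonempty set has the same positive
    weight but the empty set weighs 0. *)
Lemma hausdorff_weight_le d n p (E : set 'cV[R]_n) (F : set 'cV[R]_p) (L : R) :
  (0 <= L)%R -> (E !=set0 -> F !=set0) -> (diameter E <= L * diameter F)%R ->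
  hausdorff_weight d E <= (L ^+ d)%:E * hausdorff_weight d F.
Proof.
move=> L0 EF dEF; have [->|E0] := eqVneq E set0.
  by rewrite hausdorff_weight_set0 mule_ge0 ?hausdorff_weight_ge0// lee_fin exprn_ge0.
have F0 : F != set0 by apply/set0P/EF/set0P.
rewrite /hausdorff_weight (negbTE E0) (negbTE F0) muleA -EFinM.
rewrite lee_wpmul2r ?volume_ge0// lee_fin -exprMn lerXn2r ?nnegrE//.
- by rewrite divr_ge0 ?diameter_ge0.
- by rewrite mulr_ge0// divr_ge0 ?diameter_ge0.
- by rewrite mulrA ler_pM2r ?invr_gt0.
Qed.

Section content.
Context (d n : nat).
Implicit Types (E F : set 'cV[R]_n) (delta : R).

(** All subsets are declared measurable, so that the covers in [mu_ext] range over arbitrary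
    sets. *)
Local Notation discrete_cV :=
  (g_sigma_algebraType ([set: set 'cV[R]_n] : set (set 'cV[R]_n))).

Let bounded_by delta E := forall x y, E x -> E y -> (mxenorm (x - y) <= delta)%R.

(** The value [+oo] on large sets encodes the bound on the diameters of a cover, so the content
    becomes an instance of [mu_ext] and inherits the outer measure properties. *)
Let restricted_weight delta (E : set discrete_cV) : \bar R :=
  if `[< bounded_by delta E >] then hausdorff_weight d E else +oo.

Let restricted_weight_ge0 delta E : 0 <= restricted_weight delta E.
Proof. by rewrite /restricted_weight; case: ifPn => // _; exact: hausdorff_weight_ge0. Qed.

Let restricted_weight0 delta : restricted_weight delta set0 = 0.
Proof. by rewrite /restricted_weight ifT ?hausdorff_weight_set0//; apply/asboolP. Qed.

Let contentE delta :
  hausdorff_content d delta = mu_ext (restricted_weight delta).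
Proof.
apply/funext => E; apply/eqP; rewrite eq_le; apply/andP; split.
  apply: le_ereal_inf_tmp => _ [F [_ EF] <-].
  have [Fd|] := pselect (forall k, bounded_by delta (F k)).
    apply: ereal_inf_lbound; exists F; first by split.
    by apply: eq_eseriesr => k _; rewrite /restricted_weight ifT//; apply/asboolP.
  move=> /existsNP[k Fk]; rewrite (@eseries_pinfty _ _ xpredT k) ?leey//.
    by move=> j _; rewrite gt_eqF// (lt_le_trans _ (restricted_weight_ge0 _ _)).
  by rewrite /restricted_weight ifF//; apply/asboolPn.
apply: le_ereal_inf_tmp => _ [F [EF Fd] <-]; apply: ereal_inf_lbound.
exists F; first by split=> // k; apply: sub_sigma_algebra.
by apply: eq_eseriesr => k _; rewrite /restricted_weight ifT//; apply/asboolP; apply: Fd.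
Qed.

Lemma hausdorff_content_ge0 delta E : 0 <= hausdorff_content d delta E.
Proof. by rewrite contentE mu_ext_ge0. Qed.

Lemma hausdorff_content0 delta : hausdorff_content d delta (set0 : set 'cV[R]_n) = 0.
Proof. by rewrite contentE mu_ext0. Qed.

Lemma le_hausdorff_content delta :
  {homo @hausdorff_content R d n delta : E F / E `<=` F >-> E <= F}.
Proof. by move=> E F EF; rewrite contentE; exact: le_mu_ext. Qed.

Lemma hausdorff_content_sigma_subadditive delta :
  sigma_subadditive (@hausdorff_content R d n delta).
Proof.
move=> F; rewrite contentE.
exact: (@mu_ext_sigma_subadditive _ discrete_cV R _ (restricted_weight_ge0 delta)).
Qed.

Lemma hausdorff_content_antitone (delta delta' : R) E : (delta' <= delta)%R ->
  hausdorff_content d delta E <= hausdorff_content d delta' E.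
Proof.
move=> dd; apply: le_ereal_inf_tmp => _ [F [EF Fd] <-]; apply: ereal_inf_lbound.
by exists F => //; split => // k x y Fx Fy; apply: le_trans dd; exact: Fd Fx Fy.
Qed.

Lemma hausdorff_content_le delta E :
  (0 < delta)%R -> hausdorff_content d delta E <= hausdorff_measure d E.
Proof. by move=> d0; apply: ereal_sup_ubound; exists delta. Qed.

(** No member of a cover of mesh [delta] meets both sets, so the cover splits into two covers, and
    each member is paid for at most once. *)
Lemma hausdorff_content_separated delta E F :
  (forall x y, E x -> F y -> (delta < mxenorm (x - y))%R) ->
  hausdorff_content d delta E + hausdorff_content d delta F <=
  hausdorff_content d delta (E `|` F).
Proof.
move=> EF; apply: le_ereal_inf_tmp => _ [G [EFG Gd] <-].
pose meet (A : set 'cV[R]_n) k := if `[< G k `&` A !=set0 >] then G k else set0.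
have meet_cover A : A `<=` E `|` F -> hausdorff_cover delta A (meet A).
  move=> AEF; split=> [x Ax|k x y].
    have [k _ Gkx] := EFG x (AEF x Ax); exists k => //.
    by rewrite /meet ifT//; apply/asboolP; exists x.
  by rewrite /meet; case: ifPn => // _; exact: Gd.
apply: (@le_trans _ _ (\sum_(k <oo) (hausdorff_weight d (meet E k) +
    hausdorff_weight d (meet F k)))).
  rewrite nneseriesD; [|by move=> *; exact: hausdorff_weight_ge0..].
  apply: leeD; apply: ereal_inf_lbound.
    by exists (meet E) => //; apply: meet_cover; exact: subsetUl.
  by exists (meet F) => //; apply: meet_cover; exact: subsetUr.
apply: lee_nneseries => k _; first by rewrite adde_ge0 ?hausdorff_weight_ge0.
rewrite /meet; case: asboolP => [[x [Gx Ex]]|_]; last first.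
  by case: ifPn; rewrite hausdorff_weight_set0 add0e ?hausdorff_weight_ge0.
case: asboolP => [[y [Gy Fy]]|_]; last by rewrite hausdorff_weight_set0 adde0.
by have := EF _ _ Ex Fy; rewrite ltNge (Gd k).
Qed.

End content.

Section hausdorff_outer.
Context (d n : nat).

Let H0 : hausdorff_measure d (set0 : set 'cV[R]_n) = 0.
Proof.
apply/eqP; rewrite eq_le; apply/andP; split.
  by apply: ge_ereal_sup => _ [delta _ <-]; rewrite hausdorff_content0.
by rewrite -(@hausdorff_content0 d n 1); apply: hausdorff_content_le.
Qed.

Let H_ge0 (E : set 'cV[R]_n) : 0 <= hausdorff_measure d E.
Proof.
apply: le_trans (hausdorff_content_le d E ltr01). exact: hausdorff_content_ge0.
Qed.

Let le_H : {homo @hausdorff_measure R d n : E F / E `<=` F >-> E <= F}.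
Proof.
move=> E F EF; apply: ge_ereal_sup => _ [delta delta0 <-].
by apply: le_trans (hausdorff_content_le d F delta0); exact: le_hausdorff_content.
Qed.

Let H_subadditive : sigma_subadditive (@hausdorff_measure R d n).
Proof.
move=> F; apply: ge_ereal_sup => _ [delta delta0 <-].
apply: (le_trans (hausdorff_content_sigma_subadditive _ _ _)).
apply: lee_nneseries => k _; first by move=> _; exact: hausdorff_content_ge0.
exact: hausdorff_content_le.
Qed.

HB.instance Definition _ :=
  isOuterMeasure.Build R 'cV[R]_n (@hausdorff_measure R d n) H0 H_ge0 le_H H_subadditive.

End hausdorff_outer.

(** The map [g x |-> f x] is L-Lipschitz. Parametrising both sets by [I] avoids writing an inverse,
    which is how projections of patches are handled later. *)
Lemma hausdorff_measure_lipschitz d n p T (I : set T) (f : T -> 'cV[R]_n)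
    (g : T -> 'cV[R]_p) (L : R) : (0 < L)%R ->
  (forall x y, I x -> I y -> (mxenorm (f x - f y) <= L * mxenorm (g x - g y))%R) ->
  hausdorff_measure d (f @` I) <= (L ^+ d)%:E * hausdorff_measure d (g @` I).
Proof.
move=> L0 fg; apply: ge_ereal_sup => _ [delta /= delta0 <-].
have Ld : (0 < L ^+ d)%R by rewrite exprn_gt0.
have dL : (0 < delta / L)%R by rewrite divr_gt0.
apply: (@le_trans _ _ ((L ^+ d)%:E * hausdorff_content d (delta / L) (g @` I))); last first.
  by rewrite lee_pmul2l//; exact: hausdorff_content_le.
rewrite -lee_pdivrMl//; apply: le_ereal_inf_tmp => _ [F [IF Fd] <-].
rewrite lee_pdivrMl//.
rewrite -nneseriesZl; last by move=> k _; exact: hausdorff_weight_ge0.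
pose G k := f @` (I `&` g @^-1` F k).
apply: (@le_trans _ _ (\sum_(k <oo) hausdorff_weight d (G k))).
  apply: ereal_inf_lbound; exists G => //; split=> [_ [t It <-]|k x y].
    have [k _ Fk] := IF (g t) (imageP g It).
    by exists k => //; exists t.
  move=> -[s [Is Fs] <-] [t [It Ft] <-]; apply: (le_trans (fg _ _ Is It)).
  by rewrite mulrC -ler_pdivlMr//; apply: Fd Fs Ft.
apply: lee_nneseries => k _; first by move=> _; exact: hausdorff_weight_ge0.
apply: hausdorff_weight_le; first exact: ltW.
  by move=> [_ [t [It Ft] _]]; exists (g t).
apply: diameter_le; first by rewrite mulr_ge0 ?diameter_ge0// ltW.
move=> _ _ [s [Is Fs] <-] [t [It Ft] <-]; apply: (le_trans (fg _ _ Is It)).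
by rewrite ler_pM2l//; apply: diameter_ub Fs Ft; exact: Fd.
Qed.

Lemma ereal_sup_add_le (S T : set (\bar R)) (M : \bar R) :
  S !=set0 -> T !=set0 ->
  (forall s, S s -> 0 <= s) -> (forall t, T t -> 0 <= t) ->
  (forall s t, S s -> T t -> s + t <= M) -> ereal_sup S + ereal_sup T <= M.
Proof.
move=> [s0 Ss0] [t0 Tt0] S0 T0 ST.
have [->|Moo] := eqVneq M +oo; first by rewrite leey.
have fin x y : 0 <= x -> 0 <= y -> x + y <= M -> x \is a fin_num.
  move=> x0 y0 xy; rewrite ge0_fin_numE// (le_lt_trans _ (_ : M < +oo)) ?ltey//.
  by apply: le_trans xy; rewrite leeDl.
have supT : forall s, S s -> s + ereal_sup T <= M.
  move=> s Ss; have sf := fin _ _ (S0 _ Ss) (T0 _ Tt0) (ST _ _ Ss Tt0).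
  rewrite addeC -leeBrDr//; apply: ge_ereal_sup => t Tt.
  by rewrite leeBrDr// addeC; exact: ST.
have T0' : 0 <= ereal_sup T by apply: le_trans (T0 _ Tt0) (ereal_sup_ubound Tt0).
have Tf : ereal_sup T \is a fin_num.
  by apply: (fin _ s0 T0' (S0 _ Ss0)); rewrite addeC; exact: supT.
rewrite -leeBrDr//; apply: ge_ereal_sup => s Ss; rewrite leeBrDr//; exact: supT.
Qed.

(** This says that Hausdorff measure is a metric outer measure, the hypothesis of Caratheodory's
    criterion. *)
Lemma hausdorff_measure_separated d n (E F : set 'cV[R]_n) (eta : R) : (0 < eta)%R ->
  (forall x y, E x -> F y -> (eta <= mxenorm (x - y))%R) ->
  hausdorff_measure d E + hausdorff_measure d F <= hausdorff_measure d (E `|` F).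
Proof.
move=> eta0 EF; apply: ereal_sup_add_le.
- by exists (hausdorff_content d 1 E), 1%R => /=.
- by exists (hausdorff_content d 1 F), 1%R => /=.
- by move=> _ [? _ <-]; exact: hausdorff_content_ge0.
- by move=> _ [? _ <-]; exact: hausdorff_content_ge0.
move=> _ _ [d1 /= d10 <-] [d2 /= d20 <-].
(* Passing to a common smaller scale only increases both contents; [eta / 2] makes the separation
   strict. *)
pose e := Num.min (Num.min d1 d2) (eta / 2)%R.
have e0 : (0 < e)%R by rewrite !lt_min d10 d20 divr_gt0.
apply: le_trans (hausdorff_content_le d (E `|` F) e0).
apply: (@le_trans _ _ (hausdorff_content d e E + hausdorff_content d e F)).
  by apply: leeD; apply: hausdorff_content_antitone; rewrite !ge_min lexx ?orbT.
apply: hausdorff_content_separated => x y Ex Fy.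
apply: lt_le_trans (EF _ _ Ex Fy); rewrite gt_min ltr_pdivrMr// mulr2n mulrDr mulr1.
by rewrite ltrDl eta0 orbT.
Qed.

End hausdorff.

(** * Continuity of matrix operations *)

Section matrix_continuity.
Context {R : realType}.

Lemma continuous_sumr (T : topologicalType) I (s : seq I) (f : I -> T -> R) :
  (forall i, continuous (f i)) -> continuous (fun x => \sum_(i <- s) f i x).
Proof.
move=> cf; elim: s => [|i s IH] x.
  by under eq_fun do rewrite big_nil; exact: cvg_cst.
under eq_fun do rewrite big_cons; apply: (@continuousD _ R^o); [exact: cf|exact: IH].
Qed.

Lemma continuous_to_matrix (T : topologicalType) n m (f : T -> 'M[R]_(n, m)) :
  (forall i j, continuous (fun x => f x i j)) -> continuous f.
Proof.
move=> cf x; apply/cvg_ballP => e e0.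
apply: (@filterS _ (nbhs x) _ [set y | forall i j, ball (f x i j) e (f y i j)]).
  by move=> y /= h; split.
apply: filter_forall => i; apply: filter_forall => j.
exact: (cvg_ball (cf i j x) e0).
Qed.

Lemma continuous_mulmx n p m (B : 'M[R]_(n, p)) :
  continuous (fun x : 'M[R]_(p, m) => B *m x).
Proof.
apply: continuous_to_matrix => i j.
under eq_fun do rewrite mxE; apply: continuous_sumr => k x.
by apply: continuousM; [exact: cst_continuous|exact: coord_continuous].
Qed.

Lemma continuous_mxenorm_sub n m (a : 'M[R]_(n, m)) :
  continuous (fun x : 'M[R]_(n, m) => mxenorm (x - a)).
Proof.
have -> : (fun x : 'M[R]_(n, m) => mxenorm (x - a)) =
    Num.sqrt \o (fun x => \sum_i \sum_j (x i j - a i j) * (x i j - a i j)).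
  apply/funext => x; rewrite /mxenorm mxdotE/=; congr Num.sqrt.
  by do 2 (apply: eq_bigr => ? _); rewrite !mxE.
move=> x; apply: continuous_comp; last exact: sqrt_continuous.
move: x; apply: continuous_sumr => i; apply: continuous_sumr => j x.
have c : {for x, continuous (fun y : 'M[R]_(n, m) => y i j - a i j)}.
  by apply: (@continuousB _ R^o); [exact: coord_continuous|exact: cst_continuous].
by apply: (@continuousM R _ (fun y : 'M[R]_(n, m) => y i j - a i j)
  (fun y => y i j - a i j)); exact: c.
Qed.

Lemma closed_mxenorm_ball n m (a : 'M[R]_(n, m)) (r : R) :
  closed [set x | mxenorm (x - a) <= r].
Proof.
rewrite [X in closed X](_ : _ = (fun x => mxenorm (x - a)) @^-1` [set y | y <= r])//.
by apply: closed_comp; [move=> ? _; exact: continuous_mxenorm_sub|exact: closed_le].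
Qed.

End matrix_continuity.

(** * Caratheodory measurability of half-spaces *)

Section hausdorff_borel.
Context {R : realType}.

Lemma hausdorff_measure_isometry d n p T (I : set T) (f : T -> 'cV[R]_n)
    (g : T -> 'cV[R]_p) :
  (forall x y, I x -> I y -> mxenorm (f x - f y) = mxenorm (g x - g y)) ->
  hausdorff_measure d (f @` I) = hausdorff_measure d (g @` I).
Proof.
move=> fg; apply/eqP; rewrite eq_le; apply/andP; split.
  rewrite -[leRHS]mul1e -(expr1n R d); apply: hausdorff_measure_lipschitz => //.
  by move=> x y Ix Iy; rewrite mul1r fg.
rewrite -[leRHS]mul1e -(expr1n R d); apply: hausdorff_measure_lipschitz => //.
by move=> x y Ix Iy; rewrite mul1r fg.
Qed.

Lemma hausdorff_measure_translate d n (E : set 'cV[R]_n) (a : 'cV[R]_n) :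
  hausdorff_measure d [set v | E (v + a)] = hausdorff_measure d E.
Proof.
have EE : E = (fun v => v + a) @` [set v | E (v + a)].
  apply/seteqP; split => [v Ev|_ [v Ev <-]//].
  by exists (v - a); rewrite /= subrK.
rewrite [in RHS]EE -[in LHS](image_id [set v | E (v + a)]).
apply: hausdorff_measure_isometry => x y _ _.
by rewrite opprD addrACA subrr addr0.
Qed.

Section rings.
Context (d n : nat) (i : 'I_n) (a : R) (X : set 'cV[R]_n).
Local Notation H := (@hausdorff_measure R d n).
Local Open Scope ereal_scope.

(** The levels [a + t k] decrease to the hyperplane [v i 0 = a]; the rings are the slabs of [X]
    between consecutive levels. *)
Let t k : R := (k.+1%:R^-1)%R.
Let far k := X `&` [set v | (a + t k <= v i 0)%R].
Let ring k := X `&` [set v | (a + t k.+1 <= v i 0 < a + t k)%R].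

Let t_lt k : (t k.+1 < t k)%R.
Proof. by rewrite ltf_pV2 ?posrE// ltr_nat. Qed.

Let t_le k m : (m <= k)%N -> (t k <= t m)%R.
Proof. by move=> mk; rewrite lef_pV2 ?posrE// ler_nat. Qed.

Let coord_separated (E F : set 'cV[R]_n) (eta : R) : (0 < eta)%R ->
  (forall x y, E x -> F y -> (eta <= y i 0 - x i 0)%R) ->
  H E + H F <= H (E `|` F).
Proof.
move=> eta0 EF; apply: (hausdorff_measure_separated _ eta0) => x y Ex Fy.
rewrite mxenormB; apply: le_trans (ler_coord_mxenorm (y - x)%R i 0%R).
by rewrite !mxE (le_trans (EF _ _ Ex Fy))// ler_norm.
Qed.

(** Adjacent rings touch, so ring m+1 is joined to [far m], from which the skipped ring m separates
    it, and their union lies in [far m.+2]. The two terms of the bound play the roles of the even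
    and the odd rings. *)
Let sum_rings m : \sum_(j < m) H (ring j.+1) <= H (far m) + H (far m.+1).
Proof.
elim: m => [|m IH].
  by rewrite big_ord0 adde_ge0// outer_measure_ge0.
rewrite big_ord_recr /=; apply: (le_trans (leeD2r _ IH)).
rewrite -addeA addeC -addeA leeD2l//.
apply: (@le_trans _ _ (H (ring m.+1 `|` far m))).
  apply: (@coord_separated _ _ (t m - t m.+1)); first by rewrite subr_gt0.
  by move=> x y [_ /= /andP[_ hx]] [_ /= hy]; lra.
apply: le_outer_measure => x [] [Xx /=].
  by move=> /andP[? _].
by move=> h; split => //=; have := t_lt m; have := t_lt m.+1; lra.
Qed.

Let summable_rings : H X < +oo -> \sum_(0 <= j <oo) H (ring j.+1) < +oo.
Proof.
move=> Xoo; apply: (@le_lt_trans _ _ (H X + H X)); last by rewrite lte_add_pinfty.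
apply: lime_le; first by apply: is_cvg_nneseries => *; exact: outer_measure_ge0.
apply: nearW => m; rewrite big_mkord; apply: (le_trans (sum_rings m)).
by apply: leeD; apply: le_outer_measure => x [].
Qed.

Let bigcup_rings k :
  X `&` [set v | (a < v i 0)%R] `<=` far k.+1 `|` \bigcup_j ring (j + k).+1.
Proof.
move=> v [Xv /= av]; have [h|h] := leP (a + t k.+1)%R (v i 0)%R; first by left.
right.
have [m] : exists m, (t m <= v i 0 - a)%R.
  have va : (0 < v i 0 - a)%R by rewrite subr_gt0.
  have := near_infty_natSinv_lt (PosNum va).
  by case=> m _ /(_ m (leqnn m)) /= ?; exists m; exact: ltW.
(* The induction descends to the first level not exceeding [v i 0 - a], which identifies the ring
   containing [v]. *)
elim: m => [|m IH] mP.
  by have := t_le (leq0n k.+1) => ?; lra.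
have [h'|h'] := leP (t m) (v i 0 - a)%R; first exact: IH.
have km : (k < m)%N.
  rewrite ltnNge; apply/negP => mk.
  have := @t_le k.+1 m.+1 mk => ?; lra.
exists (m - k.+1)%N => //; split => //=.
rewrite (_ : (m - k.+1 + k).+1 = m); last by rewrite -addnS subnK.
apply/andP; split; lra.
Qed.

(* By [sum_rings] the series of the measures of the rings converges, so its tail, which
   bounds what [far k.+1] misses of the open half-space, tends to 0. *)
Let caratheodory_rings : H X < +oo ->
  H (X `&` [set v | (v i 0 <= a)%R]) + H (X `&` [set v | (a < v i 0)%R]) <= H X.
Proof.
move=> Xoo; set C := X `&` _; set Y := X `&` _.
have tail k : H C + H Y <= H X + \sum_(k <= j <oo) H (ring j.+1).
  apply: (@le_trans _ _ (H C + (H (far k.+1) + \sum_(k <= j <oo) H (ring j.+1)))).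
    rewrite leeD2l//; apply: (le_trans (le_outer_measure _ _ _ (@bigcup_rings k))).
    apply: (le_trans (outer_measureU2 _ _ _)); rewrite leeD2l//.
    apply: (le_trans (outer_measure_sigma_subadditive _ _)).
    rewrite -(nneseries_addn (f := fun j => H (ring j.+1)) k)//.
    by move=> j; exact: outer_measure_ge0.
  rewrite addeA leeD2r//.
  apply: (@le_trans _ _ (H (C `|` far k.+1))); last first.
    by apply: le_outer_measure => v [] [].
  apply: (@coord_separated _ _ (t k.+1)); first by rewrite invr_gt0.
  by move=> x y [_ /= hx] [_ /= hy]; lra.
have := nneseries_tail_cvg (summable_rings Xoo) (fun j _ => outer_measure_ge0 _ _).
move=> cvg0; rewrite -[leRHS]adde0.
have cvgX : (H X + \sum_(k <= j <oo) H (ring j.+1)) @[k --> \oo] --> H X + 0.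
  by apply: cvgeD => //; [rewrite fin_num_adde_defl|exact: cvg_cst].
rewrite -(cvg_lim _ cvgX)//; apply: lime_ge; last exact: nearW.
by apply/cvg_ex; eexists; exact: cvgX.
Qed.

Lemma caratheodory_halfspace :
  H (X `&` [set v | (v i 0 <= a)%R]) + H (X `&` ~` [set v | (v i 0 <= a)%R]) <= H X.
Proof.
rewrite (_ : ~` _ = [set v | (a < v i 0)%R]); last first.
  by apply/seteqP; split => v /=; rewrite ltNge => /negP.
have [Xoo|] := ltP (H X) +oo; first exact: caratheodory_rings.
by rewrite leye_eq => /eqP ->; rewrite leey.
Qed.

End rings.

End hausdorff_borel.

(** * Hausdorff measure and linear maps *)

Section hausdorff_linear.
Context {R : realType}.

Section finite_subadditivity.
Context (d n : nat) (delta : R).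

HB.instance Definition _ := isOuterMeasure.Build R 'cV[R]_n
  (@hausdorff_content R d n delta) (@hausdorff_content0 R d n delta)
  (@hausdorff_content_ge0 R d n delta) (@le_hausdorff_content R d n delta)
  (@hausdorff_content_sigma_subadditive R d n delta).

End finite_subadditivity.

Lemma outer_measure_finite_subadditive T (mu : {outer_measure set T -> \bar R})
    (J : finType) (F : J -> set T) (E : set T) :
  (forall x, E x -> exists j, F j x) -> (mu E <= \sum_(j : J) mu (F j))%E.
Proof.
move=> EF; apply: (@le_trans _ _ (mu (\big[setU/set0]_(j : J) F j))).
  by apply: le_outer_measure => x /EF[j Fx]; rewrite (bigD1 j)//=; left.
elim/big_ind2 : _ => //; first by rewrite outer_measure0.
by move=> A a B b Aa Bb; apply: (le_trans (outer_measureU2 _ _ _)); exact: leeD.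
Qed.

(** The cells are cubes of side [1/(N+1)], indexed in each coordinate by the integer part of
    [(N+1)(u_i + 1)]. On [cube 1] this runs from 0 to [2(N+1)] inclusive, whence the count. The mesh
    is estimated in the sum norm. *)
Lemma exists_grid n N : exists (J : finType) (k : 'cV[R]_n -> J),
  [/\ #|J| = ((N.+1.*2).+1 ^ n)%N,
    forall j, measurable ([set u | k u = j] : set (borel_cV R n)) &
    forall u v, cube 1 u -> cube 1 v -> k u = k v ->
      mxenorm (u - v) <= n%:R / N.+1%:R].
Proof.
pose M := N.+1.*2; pose g (u : 'cV[R]_n) i := Num.truncn (N.+1%:R * (u i 0 + 1)).
exists {ffun 'I_n -> 'I_M.+1}, (fun u => [ffun i => inord (g u i)]); split.
- by rewrite card_ffun !card_ord.
- move=> j; have -> : [set u | [ffun i => inord (g u i)] = j] =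
      \bigcap_(i in [set: 'I_n]) \bigcup_(l in [set l | inord l = j i :> 'I_M.+1])
      ((fun u : borel_cV R n => (u : 'cV[R]_n) i 0) @^-1`
        ([set x | x < l.+1%:R / N.+1%:R - 1] `&`
         ~` [set x | (0 < l)%N && (x < l%:R / N.+1%:R - 1)])).
    (* [Num.truncn] sends negative numbers to 0, so the cell [l = 0] has no lower bound. *)
    have gE u i l : g u i = l <-> (u i 0 < l.+1%:R / N.+1%:R - 1 /\
         ~ ((0 < l)%N && (u i 0 < l%:R / N.+1%:R - 1))).
      have e p : (u i 0 < p.+1%:R / N.+1%:R - 1) = (g u i <= p)%N.
        by rewrite truncn_le_nat ltrBrDr ltr_pdivlMr// mulrC.
      case: l => [|l]; first by rewrite e leqn0; split => [->//|[/eqP]].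
      rewrite !e /=; split => [->|[h /negP]]; first by rewrite leqnn ltnn.
      by rewrite -ltnNge => h'; apply/eqP; rewrite eqn_leq h.
    apply/seteqP; split => [u /= <- i _|u /= h].
      exists (g u i); first by rewrite /= ffunE.
      exact/gE.
    apply/ffunP => i; rewrite ffunE; have [l /= <- hl] := h i I.
    by congr inord; apply/gE.
  apply: fin_bigcap_measurable => // i _; apply: bigcup_measurable => l _.
  rewrite -[X in measurable X]setTI; apply: measurable_coord => //.
  apply: measurableI; last apply: measurableC.
    by rewrite -set_itvNyo; exact: measurable_itv.
  case: (0 < l)%N => /=; last first.
    by rewrite [X in measurable X](_ : _ = set0)//; apply/seteqP; split.
  by rewrite -set_itvNyo; exact: measurable_itv.
- move=> u v u1 v1 /ffunP uv; apply: (le_trans (mxenorm_le_sum _)).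
  apply: (@le_trans _ _ (\sum_(i < n) N.+1%:R^-1)); last first.
    by rewrite sumr_const card_ord mulr_natl.
  apply: ler_sum => i _; rewrite big_ord1 !mxE.
  have gM w : cube 1 w -> (g w i < M.+1)%N.
    move=> /(_ i); rewrite ler_norml => /andP[w1 w2].
    rewrite ltnS truncn_le_nat; apply: (@le_lt_trans _ _ (N.+1%:R * 2)).
      by rewrite ler_pM2l//; lra.
    by rewrite -natrM ltr_nat muln2.
  have gb w : cube 1 w -> (g w i)%:R <= N.+1%:R * (w i 0 + 1) < (g w i).+1%:R.
    move=> /(_ i); rewrite ler_norml => /andP[w1 w2].
    by apply: truncn_itv; rewrite mulr_ge0//; lra.
  have guv : g u i = g v i.
    by have := uv i; rewrite !ffunE => /(congr1 val); rewrite /= !inordK ?gM.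
  have := gb u u1; have := gb v v1; rewrite guv -[(g v i).+1%:R]natr1.
  have N0 : 0 < N.+1%:R :> R by [].
  move: (N.+1%:R : R) N0 => c c0 /andP[? ?] /andP[? ?].
  rewrite -[leRHS]mul1r ler_pdivlMr// -{1}(gtr0_norm c0) -normrM ler_norml.
  by apply/andP; split; lra.
Qed.

Local Notation H := (@hausdorff_measure R).

Lemma hausdorff_measure_cube1_fin n : (H n (@cube R n 1) < +oo)%E.
Proof.
have [w w0 wE] := @volume_unit_ball R n.
(* There are [(2(N+1)+1)^n <= (3(N+1))^n] cells, of diameter at most [n/(N+1)]: the powers of [N+1]
   cancel, and the bound is independent of the scale. *)
pose B : R := (3 * n%:R) ^+ n * w.
apply: (@le_lt_trans _ _ B%:E); last exact: ltry.
apply: ge_ereal_sup => _ [delta /= delta0 <-].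
have [N Nd] : exists N, n%:R / N.+1%:R <= delta.
  exists (Num.truncn (n%:R / delta)); rewrite ler_pdivrMr// mulrC -ler_pdivrMr//.
  exact/ltW/truncnS_gt.
have [J [k [cJ _ kP]]] := exists_grid n N.
pose F j := cube 1 `&` [set u : 'cV[R]_n | k u = j].
apply: (le_trans (@outer_measure_finite_subadditive _
  (hausdorff_content n delta) _ F _ _)).
  by move=> u u1; exists (k u).
have nN0 : 0 <= n%:R / N.+1%:R :> R by [].
have FP j x y : F j x -> F j y -> mxenorm (x - y) <= n%:R / N.+1%:R.
  by move=> [x1 <-] [y1 xy]; apply: kP.
have wF j : (hausdorff_content n delta (F j) <= ((n%:R / N.+1%:R) ^+ n * w)%:E)%E.
  apply: (@le_trans _ _ (hausdorff_weight n (F j))).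
    apply: ereal_inf_lbound; exists (fun i => if i == 0%N then F j else set0).
      split=> [x Fx|i x y]; first by exists 0%N.
      case: ifPn => // _ Fx Fy; exact: le_trans (FP _ _ _ Fx Fy) Nd.
    rewrite nneseries_recl//; last by move=> *; exact: hausdorff_weight_ge0.
    rewrite eseries0 ?adde0// => i i0 _.
    by rewrite gtn_eqF// hausdorff_weight_set0.
  rewrite /hausdorff_weight wE; case: ifPn => _.
    by rewrite lee_fin mulr_ge0 ?exprn_ge0// ltW.
  rewrite -EFinM lee_fin ler_pM2r// lerXn2r ?nnegrE ?divr_ge0 ?diameter_ge0//.
  rewrite ler_pdivrMr// (@le_trans _ _ (n%:R / N.+1%:R))//.
    by apply: diameter_le => // x y; exact: FP.
  by rewrite ler_peMr// ler1n.
apply: (@le_trans _ _ (\sum_(j : J) ((n%:R / N.+1%:R) ^+ n * w)%:E)%E).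
  by apply: lee_sum => j _; exact: wF.
rewrite sumEFin lee_fin sumr_const cJ -[leLHS]mulr_natl mulrA ler_pM2r//.
rewrite natrX -exprMn lerXn2r ?nnegrE ?mulr_ge0//.
rewrite mulrCA mulrC ler_wpM2r// ler_pdivrMr// -natrM ler_nat.
by rewrite -addnn; lia.
Qed.

Lemma hausdorff_measure_cube_fin n r : (H n (@cube R n r) < +oo)%E.
Proof.
pose s := Num.max r 1; have s0 : 0 < s by rewrite lt_max ltr01 orbT.
apply: (@le_lt_trans _ _ ((s ^+ n)%:E * H n (@cube R n 1))%E); last first.
  by rewrite lte_mul_pinfty ?lee_fin ?exprn_ge0 ?ltW ?hausdorff_measure_cube1_fin.
rewrite -[X in (_ * H n X)%E]image_id.
apply: (@le_trans _ _ (H n ((fun v => s *: v) @` @cube R n 1))).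
  apply: le_outer_measure => v vr; exists (s^-1 *: v); last first.
    by rewrite scalerA divff ?scale1r// gt_eqF.
  move=> i; rewrite mxE normrM gtr0_norm ?invr_gt0// mulrC ler_pdivrMr// mul1r.
  by rewrite (le_trans (vr i))// le_max lexx.
apply: hausdorff_measure_lipschitz => // x y _ _.
by rewrite -scalerBr mxenormZ gtr0_norm.
Qed.

(** The identity from the Caratheodory sigma-algebra to the Borel one is measurable as soon as its
    coordinates are, which reduces the claim to half-spaces. *)
Lemma hausdorff_caratheodory d n (E : set (borel_cV R n)) :
  measurable E -> (@hausdorff_measure R d n).-caratheodory E.
Proof.
move=> mE; pose C := caratheodory_type (@hausdorff_measure R d n).
have mid : measurable_fun setT (idfun : C -> borel_cV R n).
  apply: measurable_to_borel => i.
  apply: (measurability _ (RGenOInfty.measurableE R)) => //.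
  move=> _ [_ [a ->] <-]; rewrite setTI.
  rewrite (_ : _ @^-1` _ = ~` [set v : C | (v : 'cV[R]_n) i 0 <= a]); last first.
    by apply/seteqP; split => v /=; rewrite in_itv/= andbT ltNge => /negP.
  apply: (@measurableC _ C); apply: le_caratheodory_measurable => X.
  exact: caratheodory_halfspace.
by have := mid measurableT E mE; rewrite setTI.
Qed.

Lemma caratheodory_borel_measure n (mu : {outer_measure set 'cV[R]_n -> \bar R}) :
  (forall E : set (borel_cV R n), measurable E -> mu.-caratheodory E) ->
  exists nu : {measure set (borel_cV R n) -> \bar R},
    nu = mu :> (set (borel_cV R n) -> \bar R).
Proof.
move=> mmu; pose C := caratheodory_type mu.
unshelve eexists (pushforward (mu : set C -> \bar R)
  (idfun : C -> borel_cV R n) : {measure set (borel_cV R n) -> \bar R}).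
  by move=> _ E mE; rewrite setTI; exact: mmu.
by [].
Qed.

Lemma hausdorff_sigma_finite_measure n :
  exists m : {sigma_finite_measure set (borel_cV R n) -> \bar R},
    m = @hausdorff_measure R n n :> (set (borel_cV R n) -> \bar R).
Proof.
have [nu nuE] := caratheodory_borel_measure (@hausdorff_caratheodory n n).
rewrite -nuE; apply: sigma_finite_measure_of_function.
- exact: (measure0 nu).
- exact: (measure_ge0 nu).
- exact: (@measure_semi_sigma_additive _ _ _ nu).
- exists (fun k => @cube R n k%:R); first by rewrite bigcup_cube.
  move=> k; split; first exact: measurable_cube.
  by rewrite nuE hausdorff_measure_cube_fin.
Qed.

(** Both measures are translation invariant and sigma-finite, and the cube is symmetric. The product
    form avoids evaluating the constant. *)
Lemma hausdorff_measure_proportional n (E : set (borel_cV R n)) : measurable E ->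
  (H n E * volume (@cube R n 1) = volume E * H n (@cube R n 1))%E.
Proof.
move=> mE; have [m mH] := hausdorff_sigma_finite_measure n.
rewrite -mH -volE (translation_invariant_unique _ _ mE (@measurable_cube R n 1)).
- congr (_ * m _)%E; apply/seteqP; split => v /=; by rewrite cubeN.
- by move=> F a mF; rewrite mH hausdorff_measure_translate.
- by move=> F a mF; rewrite volE volume_translate.
Qed.

Lemma hausdorff_measure_mximage_borel n (B : 'M[R]_n) (E : set (borel_cV R n)) :
  B \in unitmx -> measurable E ->
  H n (mximage B E) = (`|\det B|%:E * H n E)%E.
Proof.
move=> uB mE; apply: (@mule_pfin_inj R ((1 *+ 2) ^+ n)); first by rewrite exprn_gt0.
rewrite -volume_cube// -muleA !hausdorff_measure_proportional//.
  by rewrite volume_mximage// muleA.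
have -> : mximage B E = [set v | E (invmx B *m v)].
  apply/seteqP; split => [_ [v Ev <-] /=|v Ev]; first by rewrite mulKmx.
  by exists (invmx B *m v); rewrite ?mulKVmx.
exact: measurable_mulmx_preimage.
Qed.

(* For [r = diameter E], [r_hull r E] is a closed set containing [E] and of the same
   diameter. *)
Let r_close n (r : R) (E : set 'cV[R]_n) := [set x | forall y, E y -> mxenorm (x - y) <= r].
Let r_hull n (r : R) (E : set 'cV[R]_n) := r_close r (r_close r E) `&` r_close r E.

Let measurable_r_close n r (E : set 'cV[R]_n) :
  measurable (r_close r E : set (borel_cV R n)).
Proof.
apply: closed_borel; rewrite (_ : r_close r E = \bigcap_(y in E) [set x | mxenorm (x - y) <= r]).
  by apply: closed_bigI => y _; exact: closed_mxenorm_ball.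
by apply/seteqP; split.
Qed.

(** The members of a nearly optimal cover are replaced by closed sets of no larger diameter, whose
    union is Borel. *)
Let borel_cover d n (F : set 'cV[R]_n) (delta e : R) : 0 < delta -> 0 < e ->
  (H d F < +oo)%E ->
  exists G : set (borel_cV R n), [/\ measurable G, F `<=` G &
    (hausdorff_content d delta G <= H d F + e%:E)%E].
Proof.
move=> d0 e0 Foo; have cle := hausdorff_content_le d F d0.
have cF : hausdorff_content d delta F \is a fin_num.
  by rewrite ge0_fin_numE ?hausdorff_content_ge0// (le_lt_trans cle).
have [_ [C [FC Cd] <-] Cs] := lb_ereal_inf_adherent e0 cF.
pose h k := if C k == set0 then set0 else r_hull (diameter (C k)) (C k).
exists (\bigcup_k h k); split.
- apply: bigcupT_measurable => k; rewrite /h; case: ifPn => // _.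
  by apply: measurableI; exact: measurable_r_close.
- move=> x /FC[k _ Cx]; exists k => //; rewrite /h ifN; last by apply/set0P; exists x.
  split => y Hy; first by rewrite mxenormB; exact: Hy.
  exact: (diameter_ub (Cd k)).
(* Membership of [x] in the outer [r_close] is tested against [y], which lies in the inner one. *)
have hd k x y : h k x -> h k y -> mxenorm (x - y) <= diameter (C k).
  by rewrite /h; case: ifPn => // _ [hx _] [_ hy]; exact: hx.
apply: (@le_trans _ _ (\sum_(k <oo) hausdorff_weight d (h k))%E).
  apply: ereal_inf_lbound; exists h => //; split => // k x y hx hy.
  apply: (le_trans (hd k x y hx hy)); apply: diameter_le; first exact: ltW.
  exact: Cd.
apply: (@le_trans _ _ (\sum_(k <oo) hausdorff_weight d (C k))%E).
  apply: lee_nneseries => k _; first by move=> _; exact: hausdorff_weight_ge0.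
  rewrite -[leRHS]mul1e -(expr1n R d); apply: hausdorff_weight_le => //.
    by rewrite /h; case: ifPn => [_ []//|/set0P].
  by rewrite mul1r; apply: diameter_le (diameter_ge0 _) _; exact: hd.
by apply: (le_trans (ltW Cs)); rewrite leeD2r.
Qed.

(** Borel regularity: [borel_cover] is intersected over mesh and error [1/(k+1)]. *)
Lemma hausdorff_borel_hull d n (F : set 'cV[R]_n) :
  exists G : set (borel_cV R n), [/\ measurable G, F `<=` G & (H d G <= H d F)%E].
Proof.
have [Foo|] := ltP (H d F) +oo%E; last first.
  by rewrite leye_eq => /eqP ->; exists setT; split => //; rewrite leey.
have t0 k : 0 < k.+1%:R^-1 :> R by [].
have /choice[G GP] k := borel_cover (t0 k) (t0 k) Foo.
exists (\bigcap_k G k); split.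
- by apply: bigcapT_measurable => k; have [] := GP k.
- by move=> x Fx k _; have [_ + _] := GP k; exact.
apply: ge_ereal_sup => _ [delta /= delta0 <-]; apply/lee_addgt0Pr => e e0.
have [k ke] : exists k : nat, k.+1%:R^-1 <= Num.min delta e.
  have m0 : 0 < Num.min delta e by rewrite lt_min delta0.
  have := near_infty_natSinv_lt (PosNum m0).
  by case=> k _ /(_ k (leqnn k)) /= ?; exists k; exact: ltW.
have [_ _ Gk] := GP k; move: ke; rewrite le_min => /andP[kd ke].
apply: (@le_trans _ _ (H d F + k.+1%:R^-1%:E)%E); last first.
  by rewrite leeD2l// lee_fin.
apply: le_trans Gk; apply: (le_trans (hausdorff_content_antitone _ _ kd)).
by apply: le_hausdorff_content => x; apply.
Qed.

(** For a set that need not be Borel, the scaling law is applied to a Borel hull of the image,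
    pulled back by the inverse of [B]. *)
Lemma hausdorff_measure_mximage_ge n (B : 'M[R]_n) (F : set 'cV[R]_n) :
  B \in unitmx -> (`|\det B|%:E * H n F <= H n (mximage B F))%E.
Proof.
move=> uB; have [G [mG FG HG]] := hausdorff_borel_hull n (mximage B F).
have detB : 0 < `|\det B| by rewrite normr_gt0 -unitfE -unitmxE.
apply: le_trans HG; rewrite -lee_pdivlMl// -normfV -det_inv.
rewrite -hausdorff_measure_mximage_borel ?unitmx_inv//.
apply: le_outer_measure => v Fv; exists (B *m v); rewrite ?mulKmx//.
by apply: FG; exists v.
Qed.

End hausdorff_linear.

(** * Nearly flat patches *)

Section surface_patch.
Context {R : realType}.
Local Notation H := (@hausdorff_measure R).

(* In orthonormal bases whose first vectors are [v] and the normalisation of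
   [A^-T v], the matrix of [A] is block triangular; its lower block [B] is the
   restriction of [A] to the hyperplane orthogonal to [v], and
   [|det B| = |A^-T v|]. *)
Lemma hausdorff_measure_mximage_patch d (A : 'M[R]_(1 + d)) (v : 'cV[R]_(1 + d))
    (E : set 'cV[R]_(1 + d)) (eta : R) :
  \det A = 1 -> mxenorm v = 1 -> 0 <= eta < 1 ->
  (forall y z, E y -> E z -> `|mxdot v (y - z)| <= eta * mxenorm (y - z)) ->
  ((mxenorm (invmx A^T *m v))%:E * H d E <=
   (((1 + eta * (mxenorm A * mxenorm (invmx A))) / (1 - eta)) ^+ d)%:E
     * H d (mximage A E))%E.
Proof.
move=> detA v1 /andP[eta0 eta1] Ev.
have uA : A \in unitmx by rewrite unitmxE detA unitr1.
have uAT : A^T \in unitmx by rewrite unitmx_tr.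
pose w := invmx A^T *m v; pose nw := mxenorm w.
have v0 : v != 0 by rewrite -mxenorm_gt0 v1.
have w0 : w != 0.
  by apply: contra_neq v0 => w0; rewrite -[v](mulKVmx uAT) -/w w0 mulmx0.
have nw0 : 0 < nw by rewrite mxenorm_gt0.
have nw1 : mxenorm (nw^-1 *: w) = 1.
  by rewrite mxenormZ gtr0_norm ?invr_gt0// mulVf// gt_eqF.
have [P PP Pv] := orthogonal_to_first v1.
have [Q QQ Qw] := orthogonal_to_first nw1.
have PPT := mulmx1C PP; have QQT := mulmx1C QQ.
pose M : 'M[R]_(1 + d) := Q *m A *m P^T.
have QTe : Q^T *m col_mx 1 0 = nw^-1 *: w by rewrite -Qw mulmxA QQ mul1mx.
have PTe : P^T *m col_mx 1 0 = v by rewrite -Pv mulmxA PP mul1mx.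
(* Transposed, this row is [P A^T Q^T e_1 = P A^T w / nw = P v / nw = e_1 / nw]. *)
have rM : row 0 M = nw^-1 *: (col_mx 1 0)^T.
  have -> : row 0 M = (col_mx 1 0)^T *m M.
    apply/rowP => j; transitivity (mxdot (col_mx 1 0) (col j M)).
      by rewrite first_coord_mxdot !mxE.
    rewrite mxdotE [RHS]mxE; apply: eq_bigr => k _.
    by rewrite big_ord1; congr (_ * _); [rewrite [RHS]mxE|rewrite mxE].
  rewrite /M !mulmxA -[Q]trmxK -!trmx_mul QTe linearZ/= -!scalemxAl; congr (_ *: _).
  rewrite -[A]trmxK -!trmx_mul /w mulKVmx//.
  by rewrite -Pv.
have [c [B MB]] := block_of_first_row rM.
have detB : `|\det B| = nw.
  have : `|\det M| = 1.
    rewrite /M !det_mulmx !normrM det_tr detA normr1 mulr1.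
    by rewrite (norm_det_orthogonal PP) (norm_det_orthogonal QQ) mulr1.
  rewrite MB det_lblock det_scalar1 normrM gtr0_norm ?invr_gt0// => e.
  by rewrite -[LHS](mulVKf (lt0r_neq0 nw0)) e mulr1.
have uB : B \in unitmx by rewrite unitmxE unitfE -normr_gt0 detB.
(* Coordinates of the orthogonal projection onto the hyperplane orthogonal to [v]. *)
pose p (y : 'cV[R]_(1 + d)) : 'cV[R]_d := dsubmx (P *m y).
have pB y z : p (y - z) = p y - p z by rewrite /p mulmxBr linearB.
have Pz z : P *m z = col_mx ((mxdot v z)%:M) (p z).
  rewrite -[LHS]vsubmxK; congr col_mx; apply/matrixP => i j; rewrite !ord1.
  rewrite -PTe mxdot_mulmxl trmxK first_coord_mxdot !mxE eqxx mulr1n.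
  by apply: eq_bigr => k _; congr (P _ _ * _); exact/val_inj.
have ncol (n : nat) (a : R) (x : 'cV[R]_n) :
    mxenorm (col_mx (a%:M : 'cV[R]_1) x) <= `|a| + mxenorm x.
  have -> : col_mx (a%:M : 'cV[R]_1) x = a *: col_mx 1 0 + col_mx 0 x.
    rewrite scale_col_mx add_col_mx scaler0 add0r addr0 -[a in LHS]mulr1.
    by rewrite scalar_mxM mul_scalar_mx.
  apply: (le_trans (mxenormD _ _)); rewrite mxenormZ /mxenorm.
  rewrite !mxdot_col_mx mxdot0l !mxE mul0r add0r mulr1 addr0 sqrtr1 mulr1.
  exact: lexx.
have ncol0 (n : nat) (x : 'cV[R]_n) : mxenorm (col_mx (0 : 'cV[R]_1) x) = mxenorm x.
  by rewrite /mxenorm mxdot_col_mx !mxE mul0r add0r.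
have eta1' : 0 < 1 - eta by rewrite subr_gt0.
have zp y z : E y -> E z -> mxenorm (y - z) <= (1 - eta)^-1 * mxenorm (p y - p z).
  move=> Ey Ez; rewrite mulrC ler_pdivlMr// mulrBr mulr1 lerBlDl -pB.
  rewrite -(mxenorm_orthogonal (y - z) PP) {1}Pz; apply: (le_trans (ncol _ _ _)).
  by rewrite lerD2r mxenorm_orthogonal// mulrC; exact: Ev.
pose L := 1 + eta * (mxenorm A * mxenorm (invmx A)).
have AA0 : 0 <= mxenorm A * mxenorm (invmx A) by rewrite mulr_ge0 ?mxenorm_ge0.
have L0 : 0 < L by rewrite ltr_pwDl// mulr_ge0.
(* [B (p x)] has the norm of the part of [A x - (v . x) A v] below the first coordinate of [Q],
   where the first coordinate vanishes; the correction is at most [eta |x| |A|], and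
   [|x| <= |A^-1| |A x|]. *)
have zB y z : E y -> E z ->
    mxenorm (B *m p y - B *m p z) <= L * mxenorm (A *m y - A *m z).
  move=> Ey Ez; rewrite -!mulmxBr -pB; move: (Ev y z Ey Ez); move: (y - z) => x vx.
  have -> : mxenorm (B *m p x) = mxenorm (A *m x - mxdot v x *: (A *m v)).
    rewrite -(mxenorm_orthogonal (A *m x - _) QQ) -(ncol0 _ (B *m p x)); congr mxenorm.
    have -> : col_mx 0 (B *m p x) = M *m col_mx 0 (p x).
      by rewrite MB mul_block_col !mulmx0 !mul0mx !add0r.
    have -> : col_mx 0 (p x) = P *m x - mxdot v x *: (P *m v).
      rewrite Pz Pv scale_col_mx scaler0 opp_col_mx add_col_mx oppr0 addr0.
      by rewrite [mxdot v x *: 1]scalemx1 subrr.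
    rewrite /M mulmxBr -scalemxAr -!mulmxA ![P^T *m (P *m _)]mulmxA PP !mul1mx.
    by rewrite mulmxBr -scalemxAr.
  apply: (le_trans (mxenormD _ _)); rewrite mxenormN mxenormZ /L mulrDl mul1r lerD2l.
  apply: (@le_trans _ _ (eta * mxenorm x * mxenorm A)).
    apply: ler_pM; rewrite ?mxenorm_ge0//.
    by rewrite -[leRHS]mulr1 -v1 mxenorm_mulmx.
  rewrite -!mulrA ler_wpM2l// mulrC ler_wpM2l ?mxenorm_ge0//.
  by rewrite -{1}[x](mulKmx uA) mxenorm_mulmx.
have Ld : 0 < (1 - eta)^-1 ^+ d by rewrite exprn_gt0// invr_gt0.
(* The chain is [E], [p E], [B (p E)], [A E]: the outer comparisons are Lipschitz, the middle one is
   the scaling by [|det B| = nw]. *)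
have := @hausdorff_measure_lipschitz R d _ _ _ E id p _ _ zp.
rewrite image_id invr_gt0 => /(_ eta1') h1.
apply: (le_trans (lee_wpmul2l _ h1)); first by rewrite lee_fin ltW.
rewrite muleCA -/w -/nw -detB -/L.
have -> : ((L / (1 - eta)) ^+ d)%:E = (((1 - eta)^-1 ^+ d)%:E * (L ^+ d)%:E)%E.
  by rewrite -EFinM -exprMn mulrC.
rewrite -muleA lee_pmul2l//.
apply: (le_trans (hausdorff_measure_mximage_ge _ uB)).
have -> : mximage B (p @` E) = (fun y => B *m p y) @` E.
  by rewrite /mximage image_comp.
exact: (@hausdorff_measure_lipschitz R d _ _ _ E (fun y => B *m p y) (fun y => A *m y)).
Qed.

End surface_patch.

(** * Lower sums of a set function *)

Section simple_lower_sums.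
Context {R : realType}.

Import HBNNSimple.

(* The library keeps this supremum local to the definition of [integral]. Here [mu]
   is any set function. *)
Definition nnintegral d (T : measurableType d) (mu : set T -> \bar R)
    (f : T -> \bar R) : \bar R :=
  ereal_sup [set sintegral mu h |
    h in [set h : {nnsfun T >-> R} | forall x, ((h x)%:E <= f x)%E]].

(** The integral is a difference of two such suprema, for the positive and negative parts;
    [mu set0 = 0] makes the second one vanish. *)
Lemma integral_ge0_nnintegral d (T : measurableType d) (mu : set T -> \bar R)
    (D : set T) (f : T -> \bar R) : mu set0 = 0%E ->
  (forall x, 0 <= f x)%E -> integral mu D f = nnintegral mu (f \_ D).
Proof.
move=> mu0 f0; rewrite /integral -!/(nnintegral _ _).
have fD0 x : (0 <= (f \_ D) x)%E by rewrite patchE; case: ifPn.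
have posE : (f \_ D)^\+%E = f \_ D.
  by apply/funext => x; rewrite (@ge0_funeposE _ _ setT)// in_setT.
have negE : (f \_ D)^\-%E = cst 0%E.
  by apply/funext => x; rewrite (@ge0_funenegE _ _ setT)// in_setT.
rewrite posE negE (_ : nnintegral mu (cst 0%E) = 0%E) ?sube0//.
apply/eqP; rewrite eq_le; apply/andP; split.
  apply: ge_ereal_sup => _ [h /= h0 <-]; rewrite /sintegral fsbig1// => x _.
  have [->|x0] := eqVneq x 0; first by rewrite mul0e.
  rewrite preimage10 ?mu0 ?mule0// => -[t _ tx]; move/negP: x0; apply.
  by rewrite -tx eq_le fun_ge0 andbT -lee_fin h0.
apply: ereal_sup_ubound; exists nnsfun0 => //=.
rewrite /sintegral fsbig1// => x _.
have [->|x0] := eqVneq x 0; first by rewrite mul0e.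
by rewrite preimage10 ?mu0 ?mule0// => -[t _ /esym/eqP]; apply/negP.
Qed.

Lemma exists_nnsfun_sum_indic d (T : measurableType d) (J : Type) (s : seq J)
    (W : J -> set T) (b : J -> R) :
  (forall j, measurable (W j)) -> (forall j, 0 <= b j) ->
  exists h : {nnsfun T >-> R}, forall x, h x = \sum_(j <- s) b j * \1_(W j) x.
Proof.
move=> mW b0; elim: s => [|j s [h hE]].
  by exists nnsfun0 => x; rewrite big_nil.
exists (add_nnsfun (scale_nnsfun (indic_nnsfun R (mW j)) (b0 j)) h) => x.
by rewrite big_cons -hE.
Qed.

(* The values on the pieces are perturbed to be pairwise distinct: no piece is
   then merged with another one in [sintegral], and additivity of [mu] is not
   needed. *)
Lemma perturb_distinct (J : finType) (a : J -> R) (r : R) : r < 1 ->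
  (forall j, 0 <= a j) ->
  exists b : J -> R, [/\ forall j, r * a j <= b j <= a j, forall j, 0 <= b j,
    forall j, (0 < b j) = (0 < a j) &
    forall i j, 0 < a i -> 0 < a j -> b i = b j -> i = j].
Proof.
(* The ranks in [[0, 1)] break the ties among equal values of [a]. *)
move=> r1 a0; pose x (j : J) : R := (enum_rank j)%:R / #|J|%:R.
have x01 j : 0 <= x j < 1.
  have J0 : (0 < #|J|)%N by apply/card_gt0P; exists j.
  by rewrite divr_ge0//= ltr_pdivrMr ?ltr0n// mul1r ltr_nat.
have xinj i j : x i = x j -> i = j.
  have J0 : (0 < #|J|)%N by apply/card_gt0P; exists i.
  have J0' : #|J|%:R != 0 :> R by rewrite pnatr_eq0 -lt0n.
  move/(congr1 (fun y => y * #|J|%:R)); rewrite !divfK// => /eqP.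
  by rewrite eqr_nat => /eqP/val_inj/enum_rank_inj.
(* A collision between distinct values forces [|a i - a j| = e |a i x i - a j x j| <= e (a i + a
   j)], which [e < delta] excludes. *)
pose delta (p : J * J) : R :=
  if a p.1 == a p.2 then 1 else `|a p.1 - a p.2| / (a p.1 + a p.2).
have delta0 p : 0 < delta p.
  rewrite /delta; case: eqVneq => // ap; rewrite divr_gt0 ?normr_gt0 ?subr_eq0//.
  rewrite lt_def addr_ge0// andbT paddr_eq0//; apply: contra ap => /andP[/eqP-> /eqP->].
  by [].
have [e [e0 e1 ed]] : exists e : R, [/\ 0 < e, e <= Num.min (1 - r) 1 &
    forall p, e < delta p].
  have m0 : 0 < Num.min (1 - r) 1 by rewrite lt_min subr_gt0 r1 ltr01.
  have : \forall e \near (0 : R)^'+, [/\ 0 < e, e <= Num.min (1 - r) 1 &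
      forall p, e < delta p].
    near=> e; split.
    - by near: e; exact: nbhs_right_gt.
    - by near: e; exact: nbhs_right_le.
    - by near: e; apply: filter_forall => p; exact: nbhs_right_lt.
  by move/filter_ex.
exists (fun j => a j * (1 - e * x j)).
move: e1; rewrite le_min => /andP[er e1].
have ex j : 0 <= e * x j <= e.
  have /andP[x0 /ltW x1] := x01 j.
  by rewrite mulr_ge0 ?(ltW e0)//= ler_piMr// ltW.
have ex1 j : e * x j < 1.
  have /andP[x0 x1] := x01 j; apply: le_lt_trans x1.
  by rewrite ler_piMl.
split.
- move=> j; have /andP[h1 h2] := ex j; rewrite mulrC.
  rewrite ler_wpM2l//=; last by lra.
  by rewrite ler_piMr//; lra.
- by move=> j; rewrite mulr_ge0// subr_ge0 ltW.
- by move=> j; rewrite pmulr_lgt0// subr_gt0.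
move=> i j ai aj; have [aij|aij] := eqVneq (a i) (a j).
  rewrite aij => /(mulfI (lt0r_neq0 aj))/addrI/oppr_inj/(mulfI (lt0r_neq0 e0)).
  exact: xinj.
move=> abij; exfalso; have := ed (i, j); rewrite /delta/= (negbTE aij).
apply/negP; rewrite -leNgt ler_pdivrMr ?addr_gt0//.
have -> : a i - a j = e * (a i * x i - a j * x j) by lra.
rewrite normrM gtr0_norm// ler_pM2l//.
have /andP[i0 i1] := x01 i; have /andP[j0 j1] := x01 j.
by rewrite ler_norml; apply/andP; split; nra.
Unshelve. all: by end_near. Qed.

(** If two pieces shared a value, [sintegral] would measure their union, which may be less than the
    sum for a [mu] that is not additive. The perturbed values [b j >= r a j] prevent this, and [r]
    is arbitrary below 1. *)
Lemma nnintegral_ge_sum d (T : measurableType d) (mu : set T -> \bar R)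
    (f : T -> \bar R) (J : finType) (W : J -> set T) (a : J -> R) :
  mu set0 = 0%E -> (forall A, 0 <= mu A)%E ->
  (forall j, measurable (W j)) ->
  (forall i j x, W i x -> W j x -> i = j) ->
  (forall j, 0 <= a j) -> (forall x, 0 <= f x)%E ->
  (forall j x, W j x -> (a j)%:E <= f x)%E ->
  (\sum_j (a j)%:E * mu (W j) <= nnintegral mu f)%E.
Proof.
move=> mu0 mu_ge0 mW Wdisj a0 f0 af.
apply/lee_mul01Pr; first by rewrite sume_ge0// => j _; rewrite mule_ge0 ?lee_fin.
move=> r /andP[r0 r1]; have [b [ab b0 bgt binj]] := perturb_distinct r1 a0.
have [h hE] := exists_nnsfun_sum_indic (index_enum J) mW b0.
have hW j x : W j x -> h x = b j.
  move=> Wx; rewrite hE (bigD1 j)//= indicE mem_set// mulr1 big1 ?addr0// => i ij.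
  rewrite indicE memNset ?mulr0// => Wi; move/negP: ij; apply.
  by rewrite (Wdisj _ _ _ Wi Wx).
have h0 x : (forall j, ~ W j x) -> h x = 0.
  by move=> Wx; rewrite hE big1// => j _; rewrite indicE memNset ?mulr0.
have hf x : ((h x)%:E <= f x)%E.
  have [[j Wx]|/forallNP/h0 ->//] := pselect (exists j, W j x).
  rewrite (hW _ _ Wx); apply: le_trans (af _ _ Wx); rewrite lee_fin.
  by case/andP: (ab j).
apply: (@le_trans _ _ (sintegral mu h)); last by apply: ereal_sup_ubound; exists h.
(* Pieces with [a j = 0] have [b j = 0] and merge with the complement, at a level that contributes
   nothing. *)
pose D := [set j | 0 < a j].
have -> : sintegral mu h = (\sum_(x \in b @` D) x%:E * mu (h @^-1` [set x]))%E.
  apply/esym/fsbig_widen => // x [_ Dx] /=.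
  have [->|x0] := eqVneq x 0; first by rewrite mul0e.
  rewrite preimage10 ?mu0 ?mule0// => -[t _ tx]; apply: Dx.
  have [[j Wt]|/forallNP/h0] := pselect (exists j, W j t); last first.
    by rewrite tx => /eqP; rewrite (negbTE x0).
  exists j; last by rewrite -(hW _ _ Wt).
  by rewrite /D /= -bgt lt_def b0 andbT -(hW _ _ Wt) tx.
rewrite fsbig_image; last first.
  by move=> i j /set_mem Di /set_mem Dj; exact: binj.
have -> : (\sum_(i \in D) (b i)%:E * mu (h @^-1` [set b i]) =
    \sum_(j | (0 < a j)%R) (b j)%:E * mu (W j))%E.
  transitivity (\sum_(j | (0 < a j)%R) (b j)%:E * mu (h @^-1` [set b j]))%E.
    by rewrite [RHS](bigfs _ (index_enum_uniq _))// => j _; rewrite mem_index_enum.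
  apply: eq_bigr => j aj; congr (_ * mu _)%E; apply/seteqP; split => x /=; last exact: hW.
  have [[i Wx]|/forallNP/h0] := pselect (exists j, W j x); last first.
    by move=> -> b0j; move: aj; rewrite -bgt -b0j ltxx.
  rewrite (hW _ _ Wx) => bij; have ai : 0 < a i by rewrite -bgt bij bgt.
  by rewrite -(binj _ _ ai aj bij).
rewrite ge0_sume_distrr; last by move=> j _; rewrite mule_ge0 ?lee_fin.
rewrite [leRHS]big_mkcond/=; apply: lee_sum => j _; case: ifPn => [aj|].
  rewrite muleA -EFinM; apply: lee_wpmul2r => //; rewrite lee_fin.
  by case/andP: (ab j).
by rewrite -leNgt => aj; rewrite (_ : a j = 0) ?mul0e ?mule0//; apply/le_anti/andP.
Qed.

End simple_lower_sums.

(** * Surface area and linear maps *)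

Section surface_area.
Context {R : realType}.

Lemma sup_scale (S : set R) (c : R) : 0 < c -> sup [set c * x | x in S] = c * sup S.
Proof.
have le (c' : R) (S' : set R) : 0 < c' -> has_sup S' ->
    has_sup [set c' * x | x in S'] /\ sup [set c' * x | x in S'] <= c' * sup S'.
  move=> c'0 [[x Sx] ubS].
  have ub : ubound [set c' * x | x in S'] (c' * sup S').
    by move=> _ [y Sy <-]; rewrite ler_pM2l//; exact: ub_le_sup.
  split; last by apply: ge_sup => //; exists (c' * x), x.
  by split; [exists (c' * x), x|exists (c' * sup S')].
move=> c0; have ci0 : 0 < c^-1 by rewrite invr_gt0.
have SE : S = [set c^-1 * y | y in [set c * x | x in S]].
  rewrite image_comp -[LHS]image_id; apply: eq_imagel => x _ /=.
  by rewrite mulKf// gt_eqF.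
have [hS|hS] := pselect (has_sup S).
  have [hcS cS] := le c S c0 hS; apply/eqP; rewrite eq_le cS/=.
  have [_] := le c^-1 _ ci0 hcS; rewrite -SE => h.
  by rewrite mulrC -ler_pdivlMr// mulrC.
rewrite (sup_out hS) mulr0 sup_out// => hcS; apply: hS; rewrite SE.
by have [] := le c^-1 _ ci0 hcS.
Qed.

Section support.
Context {n m : nat}.
Implicit Types (K : set 'M[R]_(n, m)) (x : 'M[R]_(n, m)).

Lemma support_functionZ K c x : 0 < c ->
  support_function K (c *: x) = c * support_function K x.
Proof.
move=> c0; rewrite -sup_scale// image_comp; congr sup.
by apply: eq_imagel => y _ /=; rewrite mxdotZl.
Qed.

Lemma support_function_mximage K (A : 'M[R]_n) x :
  support_function (mximage A K) x = support_function K (A^T *m x).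
Proof.
rewrite /support_function /mximage image_comp; congr sup.
by apply: eq_imagel => y _ /=; rewrite mxdot_mulmxr.
Qed.

Lemma support_function_ge0 K x : K 0 -> 0 <= support_function K x.
Proof.
move=> K0; rewrite /support_function.
have [hS|/sup_out->//] := pselect (has_sup [set mxdot x y | y in K]).
by case: hS => _ hS; apply: ub_le_sup => //; exists 0 => //; rewrite mxdot0r.
Qed.

End support.

(* The outer unit normal at [A y] of the image by [A] of a body whose outer unit
   normal at [y] is [u]. *)
Definition image_normal n (A : 'M[R]_n) (u : 'cV[R]_n) : 'cV[R]_n :=
  (mxenorm (invmx A^T *m u))^-1 *: (invmx A^T *m u).

Section image_normal.
Context {n : nat} (A : 'M[R]_n).
Hypothesis uA : A \in unitmx.

Lemma inv_trmx_norm_gt0 (u : 'cV[R]_n) : unit_sphere u ->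
  0 < mxenorm (invmx A^T *m u).
Proof.
move=> u1; rewrite mxenorm_gt0; apply/eqP => w0.
have uAT : A^T \in unitmx by rewrite unitmx_tr.
have : mxenorm u = 0 by rewrite -[u](mulKVmx uAT) w0 mulmx0 mxenorm0.
by rewrite u1 => /eqP; rewrite oner_eq0.
Qed.

Lemma image_normal_sphere u : unit_sphere u -> unit_sphere (image_normal A u).
Proof.
move=> /inv_trmx_norm_gt0 w0; rewrite /unit_sphere/= mxenormZ.
by rewrite gtr0_norm ?invr_gt0// mulVf// gt_eqF.
Qed.

Lemma image_normalK u : unit_sphere u ->
  image_normal (invmx A) (image_normal A u) = u.
Proof.
move=> u1; have w0 := inv_trmx_norm_gt0 u1.
have uAT : A^T \in unitmx by rewrite unitmx_tr.
have e : invmx (invmx A)^T *m image_normal A u = (mxenorm (invmx A^T *m u))^-1 *: u.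
  by rewrite trmx_inv invmxK -scalemxAr mulKVmx.
rewrite {1}/image_normal e mxenormZ (u1 : mxenorm u = 1) mulr1 gtr0_norm ?invr_gt0// invrK scalerA.
by rewrite mulfV ?scale1r// gt_eqF.
Qed.

Lemma measurable_image_normal :
  measurable_fun setT (image_normal A : borel_cV R n -> borel_cV R n).
Proof.
have mw : measurable_fun setT
    (fun u : borel_cV R n => invmx A^T *m (u : 'cV[R]_n) : borel_cV R n).
  exact: (measurable_borel_mulmx _ (@measurable_id _ (borel_cV R n) setT)).
apply: measurable_borel_scale => //.
have -> : (fun u : borel_cV R n => (mxenorm (invmx A^T *m (u : 'cV[R]_n)))^-1) =
    (fun u : borel_cV R n => mxenorm (invmx A^T *m (u : 'cV[R]_n)) `^ (-1)).
  by apply/funext => u; rewrite powR_inv1// mxenorm_ge0.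
apply: (measurableT_comp (measurable_powR _)).
exact: (measurableT_comp (@measurable_mxenorm R n)).
Qed.

End image_normal.

(** The inverse Gauss image of [W], named so that outer measure lemmas apply to it. *)
Definition normal_preimage n (K W : set 'cV[R]_n) : set 'cV[R]_n :=
  [set y | (closure K `\` K°) y /\ exists2 u, W u & outer_unit_normal K y u].

Lemma surface_area_measureE n (K : set 'cV[R]_n) (W : set (borel_cV R n)) :
  surface_area_measure K W = hausdorff_measure n.-1 (normal_preimage K W).
Proof. by []. Qed.

(** A small step from [y] along [u] would increase the product with [u]. An image point is thus
    recognised as a boundary point from its normal alone. *)
Lemma outer_normal_not_interior n (K : set 'cV[R]_n) y u :
  outer_unit_normal K y u -> ~ K° y.
Proof.
move=> [u1 Ku] /nbhs_ballP[e /= e0 eK].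
have /eK/Ku : ball y e (y + (e / 2) *: u).
  split => // i j; rewrite /ball/= !mxE opprD addNKr normrN normrM.
  rewrite gtr0_norm ?divr_gt0// (@le_lt_trans _ _ (e / 2))//; last first.
    by rewrite ltr_pdivrMr// mulr2n mulrDr mulr1 ltrDl.
  rewrite ler_piMr ?divr_ge0 ?(ltW e0)//.
  by rewrite -[leRHS](u1 : mxenorm u = 1) ler_coord_mxenorm.
rewrite mxdotDl mxdotZl -mxenorm_sqr (u1 : mxenorm u = 1) expr1n mulr1.
by rewrite gerDl leNgt divr_gt0.
Qed.

Lemma normal_preimage_mximage n (A : 'M[R]_n) (K W : set 'cV[R]_n) :
  A \in unitmx -> compact K -> W `<=` @unit_sphere R n ->
  mximage A (normal_preimage K W) `<=`
  normal_preimage (mximage A K) (image_normal A @` W).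
Proof.
move=> uA cK W1 _ [y [[Ky _] [u Wu [u1 yu]]] <-].
have uAT : A^T \in unitmx by rewrite unitmx_tr.
have {}Ky : K y by apply: (compact_closed _ cK) => //; exact: norm_hausdorff.
have Au : outer_unit_normal (mximage A K) (A *m y) (image_normal A u).
  split; first exact: image_normal_sphere.
  move=> _ [z Kz <-]; rewrite !mxdotZr !mxdot_mulmxl !mulKVmx//.
  by rewrite ler_wpM2l ?invr_ge0 ?mxenorm_ge0//; exact: yu.
split; last by exists (image_normal A u) => //; exists u.
split; last exact: outer_normal_not_interior Au.
by apply: subset_closure; exists y.
Qed.

(** If [u] is normal at [y], then [u . (y - z) >= 0], and replacing [u] by [v] costs at most
    [eta |y - z|]. Exchanging [y] and [z] gives the other sign. *)
Lemma normal_close n (K W : set 'cV[R]_n) (v : 'cV[R]_n) (eta : R) : compact K ->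
  (forall u, W u -> mxenorm (u - v) <= eta) ->
  forall y z, normal_preimage K W y -> normal_preimage K W z ->
  `|mxdot v (y - z)| <= eta * mxenorm (y - z).
Proof.
move=> cK Wv; have side y z : normal_preimage K W y -> normal_preimage K W z ->
    - (eta * mxenorm (y - z)) <= mxdot v (y - z).
  move=> [[Ky _] [u Wu [u1 yu]]] [[Kz _] _].
  have {}Kz : K z by apply: (compact_closed _ cK) => //; exact: norm_hausdorff.
  have uyz : 0 <= mxdot u (y - z) by rewrite mxdotBr subr_ge0 !(mxdotC u); exact: yu.
  have := cauchy_schwarz_mxdot (u - v) (y - z); rewrite mxdotBl.
  have := ler_wpM2r (mxenorm_ge0 (y - z)) (Wv u Wu).
  lra.
move=> y z Ny Nz; rewrite ler_norml side//=.
by have := side z y Nz Ny; rewrite -(opprB y z) mxdotNr mxenormN; lra.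
Qed.

Lemma surface_area_measure_cover n (K W : set 'cV[R]_n) (J : finType)
    (F : J -> set 'cV[R]_n) :
  (forall u, W u -> exists j, F j u) ->
  (surface_area_measure K W <= \sum_j surface_area_measure K (F j))%E.
Proof.
move=> WF; rewrite surface_area_measureE.
apply: (@outer_measure_finite_subadditive R _ (@hausdorff_measure R n.-1 n) J
  (fun j => normal_preimage K (F j))).
move=> y [Ky [u /WF[j Fu] yu]]; exists j; split => //; by exists u.
Qed.

Lemma surface_area_measure_set0 n (K : set 'cV[R]_n) :
  surface_area_measure K set0 = 0%E.
Proof.
rewrite surface_area_measureE (_ : normal_preimage K set0 = set0).
  exact: outer_measure0.
by rewrite -subset0 => y [_ []].
Qed.

Lemma surface_area_measure_ge0 n (K : set 'cV[R]_n) W :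
  (0 <= surface_area_measure K W)%E.
Proof. by rewrite surface_area_measureE; exact: outer_measure_ge0. Qed.

Lemma surface_area_measure_patch d (A : 'M[R]_d.+1) (K W : set 'cV[R]_d.+1)
    (v : 'cV[R]_d.+1) (eta : R) :
  \det A = 1 -> compact K -> W `<=` @unit_sphere R d.+1 -> mxenorm v = 1 ->
  0 <= eta < 1 -> (forall u, W u -> mxenorm (u - v) <= eta) ->
  ((mxenorm (invmx A^T *m v))%:E * surface_area_measure K W <=
   (((1 + eta * (mxenorm A * mxenorm (invmx A))) / (1 - eta)) ^+ d)%:E
     * surface_area_measure (mximage A K) (image_normal A @` W))%E.
Proof.
move=> detA cK W1 v1 eta01 Wv.
have uA : A \in unitmx by rewrite unitmxE detA unitr1.
have NW := normal_close cK Wv.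
apply: (le_trans (hausdorff_measure_mximage_patch detA v1 eta01 NW)).
have /andP[eta0 eta1] := eta01.
apply: lee_wpmul2l.
  rewrite lee_fin exprn_ge0// divr_ge0 ?subr_ge0 ?(ltW eta1)//.
  by rewrite addr_ge0// !mulr_ge0 ?mxenorm_ge0.
by apply: le_outer_measure; exact: normal_preimage_mximage.
Qed.

End surface_area.

(** * Change of variables on the sphere *)

Section orlicz.
Context {R : realType}.

Import HBNNSimple.

Lemma exists_small_expansion (k : nat) (r : R) : 0 < r < 1 ->
  exists2 x : R, 0 < x & r * (1 + x) ^+ k <= 1.
Proof.
move=> /andP[r0 r1].
(* Bernoulli: [(1 - x) ^+ k >= 1 - k x >= r]. *)
pose x : R := (1 - r) / k.+1%:R.
have x0 : 0 < x by rewrite divr_gt0// subr_gt0.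
have x1 : x <= 1.
  by rewrite ler_pdivrMr// mul1r (@le_trans _ _ 1)// ?ler1n//; lra.
have bern j : 1 - j%:R * x <= (1 - x) ^+ j.
  elim: j => [|j IH]; first by rewrite mul0r subr0 expr0.
  rewrite exprS -natr1; apply: (@le_trans _ _ ((1 - x) * (1 - j%:R * x))).
    have : 0 <= j%:R * x * x by apply: mulr_ge0 (ltW x0); exact: mulr_ge0 (ltW x0).
    lra.
  by rewrite ler_wpM2l// subr_ge0.
exists x => //; apply: (@le_trans _ _ ((1 - x) ^+ k * (1 + x) ^+ k)).
  rewrite ler_wpM2r//; first by rewrite exprn_ge0// addr_ge0// ltW.
  apply: le_trans (bern k).
  have : k%:R * x <= k.+1%:R * x by rewrite ler_wpM2r ?(ltW x0)// ler_nat.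
  have -> : k.+1%:R * x = 1 - r by rewrite mulrC divfK.
  move=> h; lra.
rewrite -exprMn exprn_ile1//; nra.
Qed.

Lemma exists_small_distortion (k : nat) (r C C' : R) : 0 < r < 1 -> 0 <= C -> 0 <= C' ->
  exists eta : R, [/\ 0 < eta, eta < 1 &
    r * ((1 + eta * C) / (1 - eta)) ^+ k * (1 + eta * C') <= 1].
Proof.
move=> r01 C0 C'0; have [x x0 xr] := exists_small_expansion k.+1 r01.
(* For [eta <= 1/2] the quotient is at most [1 + 2 (1 + C) eta], so [eta M <= x] bounds each of the
   k+1 factors by [1 + x]. *)
pose M := 2 * (1 + C) + C'; have M0 : 0 < M by rewrite /M; lra.
pose eta := Num.min 2^-1 (x / M).
have eta0 : 0 < eta by rewrite lt_min invr_gt0 ltr0n divr_gt0.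
have eta2 : eta <= 2^-1 by rewrite ge_min lexx.
have etax : eta * M <= x by rewrite -ler_pdivlMr// ge_min lexx orbT.
have half : 2^-1 * 2 = 1 :> R by rewrite mulVf.
have eta1 : eta < 1 by nra.
have /andP[r0 _] := r01.
exists eta; split => //; apply: le_trans xr; rewrite exprSr mulrA.
have C1 : (1 + eta * C) / (1 - eta) <= 1 + x.
  rewrite ler_pdivrMr ?subr_gt0//; apply: (@le_trans _ _ ((1 + eta * M) * (1 - eta))).
    have : 0 <= eta * C by rewrite mulr_ge0// ltW.
    have : 0 <= eta * C' by rewrite mulr_ge0// ltW.
    rewrite /M; nra.
  by rewrite ler_wpM2r ?subr_ge0 ?(ltW eta1)//; lra.
have C2 : 1 + eta * C' <= 1 + x.
  rewrite lerD2l; apply: le_trans etax; rewrite ler_wpM2l ?(ltW eta0)// /M; lra.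
have D0 : 0 <= (1 + eta * C) / (1 - eta).
  by rewrite divr_ge0 ?subr_ge0 ?(ltW eta1)// addr_ge0// mulr_ge0// ltW.
apply: ler_pM => //.
- by rewrite mulr_ge0 ?(ltW r0)// exprn_ge0.
- by rewrite addr_ge0// mulr_ge0// ltW.
by rewrite ler_wpM2l ?(ltW r0)// lerXn2r// nnegrE addr_ge0// ltW.
Qed.

Lemma measurable_unit_sphere n : measurable (@unit_sphere R n : set (borel_cV R n)).
Proof.
have -> : @unit_sphere R n =
    (fun v : borel_cV R n => mxenorm (v : 'cV[R]_n)) @^-1` [set 1] by [].
by rewrite -[X in measurable X]setTI; apply: measurable_mxenorm.
Qed.

Lemma measurable_image_normal_image n (A : 'M[R]_n) (W : set (borel_cV R n)) :
  A \in unitmx -> measurable W -> W `<=` @unit_sphere R n ->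
  measurable (image_normal A @` W : set (borel_cV R n)).
Proof.
move=> uA mW W1.
have -> : image_normal A @` W = @unit_sphere R n `&` image_normal (invmx A) @^-1` W.
  apply/seteqP; split => [_ [u Wu <-]|u' [u1 Wu]].
    by split; [exact/image_normal_sphere/W1|rewrite /= image_normalK//; exact: W1].
  exists (image_normal (invmx A) u') => //.
  by rewrite -{1}[A]invmxK image_normalK// unitmx_inv.
apply: measurableI; first exact: measurable_unit_sphere.
rewrite -[X in measurable X]setTI.
by apply: measurable_image_normal.
Qed.

Lemma sintegral_range d (T : measurableType d) (mu : set T -> \bar R)
    (h : {nnsfun T >-> R}) : mu set0 = 0%E ->
  exists s : seq R, [/\ uniq s, forall x, h x \in s, forall y, y \in s -> 0 <= y &
    sintegral mu h = (\sum_(i < size s) (s`_i)%:E * mu (h @^-1` [set s`_i]))%E].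
Proof.
move=> mu0; have fh : finite_set (range h) by exact: fimfunP.
exists (finmap.enum_fset (fset_set (range h))); split.
- exact: finmap.fset_uniq.
- by move=> x; rewrite in_fset_set// mem_set//; exists x.
- by move=> y; rewrite in_fset_set// => /set_mem[t _ <-]; exact: fun_ge0.
rewrite /sintegral -(fsbig_widen (range h)) => //; last first.
  by move=> x [_ xh] /=; rewrite preimage10 ?mu0 ?mule0.
by rewrite fsbig_finite//= (big_nth 0) big_mkord.
Qed.

(* [g'] is related to [g] as the densities of one and the same measure with
   respect to the surface area measures of [mximage A K] and [K]. *)
Lemma nnintegral_surface_le d (A : 'M[R]_d.+1) (K : set 'cV[R]_d.+1)
    (g g' : borel_cV R d.+1 -> \bar R) :
  \det A = 1 -> compact K ->
  (forall u, 0 <= g u)%E -> (forall u, 0 <= g' u)%E ->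
  (forall u, ~ unit_sphere (u : 'cV[R]_d.+1) -> g u = 0%E) ->
  (forall u : 'cV[R]_d.+1, unit_sphere u ->
    g' (image_normal A u) = ((mxenorm (invmx A^T *m u))^-1%:E * g u)%E) ->
  (nnintegral (surface_area_measure K) g <=
   nnintegral (surface_area_measure (mximage A K)) g')%E.
Proof.
move=> detA cK g0 g'0 gsphere gg'.
have uA : A \in unitmx by rewrite unitmxE detA unitr1.
have uAT : A^T \in unitmx by rewrite unitmx_tr.
pose mu := surface_area_measure K; pose mu' := surface_area_measure (mximage A K).
pose w (u : 'cV[R]_d.+1) := mxenorm (invmx A^T *m u).
have w0 u : unit_sphere u -> 0 < w u by exact: inv_trmx_norm_gt0.
apply: ge_ereal_sup => _ [h /= hg <-].
have mu0 : mu set0 = 0%E by exact: surface_area_measure_set0.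
have [s [us hs s0 hE]] := sintegral_range h mu0; rewrite -/mu hE.
apply/lee_mul01Pr.
  apply: sume_ge0 => i _; rewrite mule_ge0 ?lee_fin ?s0 ?mem_nth//.
  exact: surface_area_measure_ge0.
move=> r r01; have /andP[r0 r1] := r01.
pose C := mxenorm A * mxenorm (invmx A).
(* For unit [u], [v] at distance at most [eta], [|A^-T (u - v)| <= eta |A^-T| |A^T| |A^-T v|], so
   [w u <= (1 + eta C') w v]. *)
pose C' := mxenorm (invmx A^T) * mxenorm A^T.
have C0 : 0 <= C by rewrite mulr_ge0 ?mxenorm_ge0.
have C'0 : 0 <= C' by rewrite mulr_ge0 ?mxenorm_ge0.
have [eta [eta0 eta1 XY]] := exists_small_distortion d r01 C0 C'0.
pose X := ((1 + eta * C) / (1 - eta)) ^+ d; pose Y := 1 + eta * C'.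
have Y0 : 0 < Y by rewrite ltr_pwDl// mulr_ge0// ltW.
have wY u v : unit_sphere u -> unit_sphere v -> mxenorm (u - v) <= eta ->
    w u <= Y * w v.
  move=> u1 v1 uv; have -> : u = v + (u - v) by rewrite addrC subrK.
  rewrite /w mulmxDr; apply: (le_trans (mxenormD _ _)).
  rewrite /Y mulrDl mul1r lerD2l; apply: (le_trans (mxenorm_mulmx _ _)).
  rewrite /C' mulrCA -!mulrA ler_wpM2l ?mxenorm_ge0//.
  apply: (le_trans uv); rewrite -[leLHS]mulr1 ler_wpM2l ?(ltW eta0)//.
  rewrite -(v1 : mxenorm v = 1) -{1}[v](mulKVmx uAT); exact: mxenorm_mulmx.
have [N Neta] : exists N, d.+1%:R / N.+1%:R <= eta.
  exists (Num.truncn (d.+1%:R / eta)); rewrite ler_pdivrMr// mulrC -ler_pdivrMr//.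
  exact/ltW/truncnS_gt.
have [J [k [_ mk kP]]] := @exists_grid R d.+1 N.
have sphere_cube (u : 'cV[R]_d.+1) : unit_sphere u -> cube 1 u.
  by move=> u1 i; rewrite -[leRHS](u1 : mxenorm u = 1) ler_coord_mxenorm.
(* On each piece [h] is constant and the normals lie in one grid cell. *)
pose W (p : 'I_(size s) * J) : set (borel_cV R d.+1) :=
  [set u | unit_sphere (u : 'cV[R]_d.+1) /\ (h u = s`_p.1 /\ k u = p.2)].
have W1 p : W p `<=` @unit_sphere R d.+1 by move=> u [].
have mh y : measurable (h @^-1` [set y]).
  by apply: measurable_sfunP; exact: measurable_set1.
have mW p : measurable (W p).
  apply: measurableI; first exact: measurable_unit_sphere.
  by apply: measurableI; [exact: (mh s`_p.1)|exact: mk].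
have Weta p u v : W p u -> W p v -> mxenorm ((u : 'cV[R]_d.+1) - v) <= eta.
  move=> [u1 [_ ku]] [v1 [_ kv]]; apply: le_trans Neta; apply: kP.
  - exact: sphere_cube.
  - exact: sphere_cube.
  - by rewrite ku kv.
pose v p : 'cV[R]_d.+1 := xget 0 (W p : set 'cV[R]_d.+1).
have Wv p u : W p u -> W p (v p) by move=> Wu; apply: (xgetI _ Wu).
(* Chosen so that [a p <= h u / w u <= g' (image_normal A u)] on [W p]. If [W p] is empty, then
   [v p = 0] and division by 0 gives [a p = 0]. *)
pose a (p : 'I_(size s) * J) : R := s`_p.1 / (Y * w (v p)).
have a0 p : 0 <= a p.
  apply: divr_ge0; first by apply: s0; exact: mem_nth.
  by apply: mulr_ge0 (mxenorm_ge0 _); exact: ltW.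
apply: (@le_trans _ _ (\sum_p (a p)%:E * mu' (image_normal A @` W p))%E); last first.
  apply: (@nnintegral_ge_sum R _ (borel_cV R d.+1) mu' g' _
    (fun p => image_normal A @` W p) a) => //.
  - exact: surface_area_measure_set0.
  - exact: surface_area_measure_ge0.
  - by move=> p; exact: measurable_image_normal_image.
  - move=> p q _ [u Wu <-] [u' Wu' uu'].
    have {}uu' : u' = u.
      by rewrite -(image_normalK uA (W1 _ _ Wu)) -uu' image_normalK//; exact: W1 Wu'.
    move: Wu Wu'; rewrite uu' => -[_ [hp kp]] [_ [hq kq]].
    case: p q hp kp hq kq => [p1 p2] [q1 q2] /= hp <- hq <-; congr pair.
    have := nth_uniq 0 (ltn_ord p1) (ltn_ord q1) us.
    by rewrite -hp -hq eqxx => /esym/eqP/val_inj.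
  move=> p _ [u Wu <-]; have u1 := W1 _ _ Wu; have v1 := W1 _ _ (Wv _ _ Wu).
  rewrite gg'//; apply: (@le_trans _ _ ((w u)^-1%:E * (s`_p.1)%:E)%E).
    rewrite -EFinM lee_fin /a mulrC ler_wpM2r ?s0 ?mem_nth//.
    rewrite lef_pV2 ?posrE ?mulr_gt0 ?w0//; apply: wY => //.
    exact: Weta Wu (Wv _ _ Wu).
  apply: lee_wpmul2l; first by rewrite lee_fin invr_ge0 ltW// w0.
  by case: Wu => _ [<- _]; exact: hg.
rewrite ge0_sume_distrr; last first.
  move=> i _; rewrite mule_ge0 ?lee_fin ?s0 ?mem_nth//.
  exact: surface_area_measure_ge0.
rewrite -(pair_bigA _ (fun i j => (a (i, j))%:E * mu' (image_normal A @` W (i, j)))%E)/=.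
(* The level 0 of [h] may leave the sphere and is set apart; a positive level stays on it, because
   [g] vanishes elsewhere, and is therefore covered by the pieces. *)
apply: lee_sum => i _; have [si0|si0] := eqVneq s`_i 0.
  rewrite si0 mul0e mule0 sume_ge0// => j _; rewrite mule_ge0 ?lee_fin//.
  exact: surface_area_measure_ge0.
have sp : 0 < s`_i by rewrite lt_def si0 s0// mem_nth.
have rs0 : 0 <= r * s`_i by rewrite mulr_ge0 ?ltW.
rewrite muleA -EFinM; apply: (@le_trans _ _ ((r * s`_i)%:E * \sum_j mu (W (i, j)))%E).
  apply: lee_wpmul2l; first by rewrite lee_fin.
  apply: surface_area_measure_cover => u /= hu.
  have [u1|/gsphere gu] := pselect (unit_sphere (u : 'cV[R]_d.+1)).
    by exists (k u); split.
  by have := hg u; rewrite hu gu lee_fin leNgt sp.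
rewrite ge0_sume_distrr; last by move=> j _; exact: surface_area_measure_ge0.
apply: lee_sum => j _.
have [->|/set0P[u Wu]] := eqVneq (W (i, j)) set0.
  rewrite [mu _]mu0 mule0 mule_ge0 ?lee_fin//.
  exact: surface_area_measure_ge0.
have v1 := W1 _ _ (Wv _ _ Wu); have wv0 := w0 _ v1.
have := surface_area_measure_patch detA cK (@W1 (i, j)) v1
  (_ : 0 <= eta < 1) (fun u Wu' => Weta _ _ _ Wu' (Wv _ _ Wu)).
rewrite (ltW eta0) eta1 => /(_ isT) h1.
(* The patch estimate absorbs [w (v (i, j))] at the price of [X]; what remains is [r X Y <= 1]. *)
rewrite (_ : r * s`_i = r * s`_i / w (v (i, j)) * w (v (i, j))); last by rewrite divfK// gt_eqF.
rewrite EFinM -muleA.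
have c0 : 0 <= r * s`_i / w (v (i, j)) by rewrite divr_ge0// ltW.
apply: (le_trans (lee_wpmul2l _ h1)); first by rewrite lee_fin.
rewrite muleA -EFinM; apply: lee_wpmul2r; first exact: surface_area_measure_ge0.
rewrite lee_fin -/C -/X /a/= ler_pdivlMr ?mulr_gt0//.
have wn0 : w (v (i, j)) != 0 by rewrite gt_eqF.
have -> : r * s`_i / w (v (i, j)) * X * (Y * w (v (i, j))) = s`_i * (r * X * Y).
  by move: (w _) wn0 => c cn0; field.
by rewrite ler_piMr// ltW.
Qed.

End orlicz.

(** * Convex bodies *)

Section convex_bodies.
Context {R : realType}.

Lemma convex_set_segment n m (K : set 'M[R]_(n, m)) x y (s : R) :
  convex_set K -> K x -> K y -> 0 <= s <= 1 -> K (s *: x + (1 - s) *: y).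
Proof.
move=> cK Kx Ky s01.
have := cK x y (Itv01 (andP s01).1 (andP s01).2) (mem_set Kx) (mem_set Ky).
by move/set_mem; congr K.
Qed.

Lemma convex_set_of_segment n m (K : set 'M[R]_(n, m)) :
  (forall x y s, K x -> K y -> 0 <= s <= 1 -> K (s *: x + (1 - s) *: y)) ->
  convex_set K.
Proof.
move=> cK x y l /set_mem Kx /set_mem Ky; apply/mem_set.
by apply: (cK x y l%:num Kx Ky); apply/andP; split.
Qed.

Lemma support_function_ub n m (K : set 'M[R]_(n, m)) x y : compact K -> K y ->
  mxdot x y <= support_function K x.
Proof.
move=> cK Ky; apply: ub_le_sup; last by exists y.
have cn : {within K, continuous (fun z : 'M[R]_(n, m) => mxenorm (z - 0))}.
  by apply: continuous_subspaceT; exact: continuous_mxenorm_sub.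
have [c _ cmax] := compact_EVT_max (ex_intro _ y Ky) cK cn.
exists (mxenorm x * mxenorm (c - 0)) => _ [z Kz <-].
apply: (le_trans (cauchy_schwarz_mxdot _ _)).
by rewrite ler_wpM2l ?mxenorm_ge0// -{1}[z]subr0 cmax// mem_set.
Qed.

(** The separating direction goes from the nearest point [p] of [K] to [y]: were [x . (z - p) > 0]
    for some [z] in [K], moving from [p] towards [z] would reduce the distance. *)
Lemma support_function_separation n m (K : set 'M[R]_(n, m)) y :
  compact K -> convex_set K -> K !=set0 -> ~ K y ->
  exists x, support_function K x < mxdot x y.
Proof.
move=> cK vK K0 Ky.
have cn : {within K, continuous (fun z : 'M[R]_(n, m) => mxenorm (z - y))}.
  by apply: continuous_subspaceT; exact: continuous_mxenorm_sub.
have [p /set_mem Kp pmin] := compact_EVT_min K0 cK cn.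
pose x := y - p; exists x.
have x0 : x != 0 by rewrite subr_eq0; apply/eqP => yp; apply: Ky; rewrite yp.
have xx : 0 < mxdot x x by rewrite -mxenorm_sqr exprn_gt0// mxenorm_gt0.
apply: (@le_lt_trans _ _ (mxdot x p)); last first.
  by rewrite -subr_gt0 -mxdotBr.
apply: ge_sup; first by case: K0 => z Kz; exists (mxdot x z), z.
move=> _ [z Kz <-]; rewrite -subr_le0 -mxdotBr leNgt; apply/negP => q0.
pose q := mxdot x (z - p); pose D := mxdot (z - p) (z - p).
have D0 : 0 <= D := mxdot_ge0 _.
(* Minimality gives [2 q <= s D], against [s (D + 1) <= q]; the added 1 keeps the denominator
   positive. *)
pose s := Num.min 1 (q / (D + 1)).
have s0 : 0 < s by rewrite lt_min ltr01 divr_gt0// ltr_wpDl.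
have s1 : s <= 1 by rewrite ge_min lexx.
have sD : s * (D + 1) <= q by rewrite -ler_pdivlMr ?ltr_wpDl// ge_min lexx orbT.
have Ks : K (s *: z + (1 - s) *: p).
  by apply: convex_set_segment => //; rewrite (ltW s0).
have := pmin _ (mem_set Ks).
have -> : s *: z + (1 - s) *: p - y = - (x - s *: (z - p)).
  by rewrite /x; apply/matrixP => i j; rewrite !mxE; ring.
rewrite mxenormN mxenormB -/x -(@ler_pXn2r _ 2) ?nnegrE ?mxenorm_ge0//.
have expand (u e : 'M[R]_(n, m)) : mxdot (u - s *: e) (u - s *: e) =
    mxdot u u - 2 * s * mxdot u e + s ^+ 2 * mxdot e e.
  by rewrite !(mxdotBl, mxdotBr, mxdotZl, mxdotZr) (mxdotC e u); ring.
rewrite !mxenorm_sqr expand -/q -/D => h.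
have qp : 0 < q := q0.
have : s * (s * (D + 1)) <= s * q by rewrite ler_wpM2l// ltW.
have : 0 < s * q by rewrite mulr_gt0.
nra.
Qed.

Lemma support_function_inj n m (P Q : set 'M[R]_(n, m)) :
  convex_body P -> convex_body Q ->
  (forall x, support_function P x = support_function Q x) -> P = Q.
Proof.
have sub (P' Q' : set 'M[R]_(n, m)) : convex_body P' -> convex_body Q' ->
    (forall x, support_function P' x = support_function Q' x) -> P' `<=` Q'.
  move=> [cP _ _] [cQ vQ [q /interior_subset Qq]] PQ y Py; apply: contrapT => Qy.
  have [|x xy] := support_function_separation cQ vQ _ Qy; first by exists q.
  by move: xy; rewrite -PQ ltNge support_function_ub.
move=> bP bQ PQ; apply/seteqP; split; first exact: sub.
by apply: sub => // x; rewrite PQ.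
Qed.

Lemma mximage_preimage n m (B : 'M[R]_n) (K : set 'M[R]_(n, m)) : B \in unitmx ->
  mximage B K = [set x | K (invmx B *m x)].
Proof.
move=> uB; apply/seteqP; split => [_ [x Kx <-] /=|x Kx]; first by rewrite mulKmx.
by exists (invmx B *m x); rewrite ?mulKVmx.
Qed.

Lemma mximageK n m (B : 'M[R]_n) (K : set 'M[R]_(n, m)) : B \in unitmx ->
  mximage (invmx B) (mximage B K) = K.
Proof.
move=> uB; rewrite (mximage_preimage (mximage B K)) ?unitmx_inv// invmxK.
rewrite mximage_preimage//; apply/seteqP; split => x /=; by rewrite mulKmx.
Qed.

Lemma convex_body_o_mximage n m (B : 'M[R]_n) (K : set 'M[R]_(n, m)) :
  B \in unitmx -> convex_body_o K -> convex_body_o (mximage B K).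
Proof.
move=> uB [[cK vK _] K0].
have B0 : (mximage B K)° 0.
  rewrite mximage_preimage//.
  have := @continuous_mulmx R n n m (invmx B) (0 : 'M[R]_(n, m)).
  by move=> /(_ K); apply; rewrite mulmx0.
split => //; split; last by exists 0.
- apply: continuous_compact => //; apply: continuous_subspaceT.
  exact: continuous_mulmx.
- apply: convex_set_of_segment => _ _ s [x Kx <-] [y Ky <-] s01.
  exists (s *: x + (1 - s) *: y); first exact: convex_set_segment.
  by rewrite mulmxDr -!scalemxAr.
Qed.

(** * The Orlicz integral under a linear map *)

Lemma orlicz_integral_mximage_ge d m (A : 'M[R]_d.+1) (K : set 'cV[R]_d.+1)
    (Phi : 'rV[R]_m -> R) (x : 'M[R]_(d.+1, m)) (t : R) :
  \det A = 1 -> compact K -> K 0 -> (forall z, 0 <= Phi z) ->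
  (orlicz_integral Phi K (invmx A *m x) t <= orlicz_integral Phi (mximage A K) x t)%E.
Proof.
move=> detA cK K0 Phi0.
have uA : A \in unitmx by rewrite unitmxE detA unitr1.
have uAT : A^T \in unitmx by rewrite unitmx_tr.
have AK0 : mximage A K 0 by exists 0; rewrite ?mulmx0.
have ge0 (K' : set 'cV[R]_d.+1) x' (u : borel_cV R d.+1) : K' 0 ->
    (0 <= (Phi ((t / support_function K' u) *: ((u : 'cV[R]_d.+1)^T *m x'))
      * support_function K' u)%:E)%E.
  by move=> K'0; rewrite lee_fin mulr_ge0// support_function_ge0.
rewrite /orlicz_integral !integral_ge0_nnintegral; try exact: surface_area_measure_set0;
  try by (move=> u; exact: ge0).
have in_sphere (u : 'cV[R]_d.+1) : unit_sphere u ->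
    (u \in (@unit_sphere R d.+1 : set (borel_cV R d.+1))) = true.
  by move=> u1; exact/mem_set.
apply: nnintegral_surface_le => //.
- by move=> u; rewrite patchE; case: ifPn => // _; exact: ge0.
- by move=> u; rewrite patchE; case: ifPn => // _; exact: ge0.
- by move=> u u1; rewrite patchE memNset.
move=> u u1; rewrite !patchE !in_sphere//; last exact: image_normal_sphere.
rewrite -EFinM; congr (_%:E).
have w0 := inv_trmx_norm_gt0 uA u1.
(* The factors [1 / |A^-T u|] from [h_AK(u')] and from [u'^T x] cancel inside [Phi]; one survives
   outside, as the density relation demands. *)
rewrite support_function_mximage /image_normal -scalemxAr mulKVmx//.
rewrite support_functionZ ?invr_gt0// mulrCA; congr (_ * (Phi _ * _)).
rewrite linearZ/= trmx_mul trmx_inv trmxK -scalemxAl scalerA mulmxA; congr (_ *: _).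
by rewrite invfM invrK [X in t * X]mulrC mulrA mulfK// gt_eqF.
Qed.

(** The reverse inequality is the previous one for [invmx A] and the body [mximage A K]. *)
Lemma orlicz_integral_mximage d m (A : 'M[R]_d.+1) (K : set 'cV[R]_d.+1)
    (Phi : 'rV[R]_m -> R) (x : 'M[R]_(d.+1, m)) (t : R) :
  \det A = 1 -> compact K -> K 0 -> (forall z, 0 <= Phi z) ->
  orlicz_integral Phi (mximage A K) x t = orlicz_integral Phi K (invmx A *m x) t.
Proof.
move=> detA cK K0 Phi0.
have uA : A \in unitmx by rewrite unitmxE detA unitr1.
have cAK : compact (mximage A K).
  apply: continuous_compact => //; apply: continuous_subspaceT.
  exact: continuous_mulmx.
have AK0 : mximage A K 0 by exists 0; rewrite ?mulmx0.
have detAV : \det (invmx A) = 1 by rewrite det_inv detA invr1.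
have le := orlicz_integral_mximage_ge (invmx A *m x) t detAV cAK AK0 Phi0.
rewrite invmxK (mulKVmx uA) (mximageK K uA) in le.
have ge := orlicz_integral_mximage_ge x t detA cK K0 Phi0.
by apply: le_anti; rewrite le ge.
Qed.

Lemma orlicz_projection_support_mximage d m (A : 'M[R]_d.+1) (K : set 'cV[R]_d.+1)
    (Phi : 'rV[R]_m -> R) (x : 'M[R]_(d.+1, m)) :
  \det A = 1 -> convex_body_o K -> (forall z, 0 <= Phi z) ->
  orlicz_projection_support Phi (mximage A K) x =
  orlicz_projection_support Phi K (invmx A *m x).
Proof.
move=> detA [[cK _ _] /interior_subset K0] Phi0.
have uA : A \in unitmx by rewrite unitmxE detA unitr1.
rewrite /orlicz_projection_support.
have -> : (invmx A *m x == 0) = (x == 0).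
  apply/eqP/eqP => [x0|->]; last by rewrite mulmx0.
  by rewrite -[x](mulKVmx uA) x0 mulmx0.
have -> : volume (mximage A K) = volume K.
  rewrite volume_mximage ?detA ?normr1 ?mul1e//; apply: closed_borel.
  by apply: compact_closed => //; exact: norm_hausdorff.
have -> : orlicz_integral Phi (mximage A K) x = orlicz_integral Phi K (invmx A *m x).
  by apply/funext => t; exact: orlicz_integral_mximage.
reflexivity.
Qed.

End convex_bodies.

Theorem proposition4p3 (R : realType) (n m : nat) (hn : (0 < n)%N)
    (hm : (0 < m)%N) (Phi : 'rV[R]_m -> R) (hPhi : orlicz_class Phi)
    (K : set 'cV[R]_n) (hK : convex_body_o K)
    (A : 'M[R]_n) (hA : \det A = 1) :
  orlicz_projection_body Phi (mximage A K)
  = mximage (invmx A^T) (orlicz_projection_body Phi K).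
Proof.
case: n hn K hK A hA => [//|d] _ K hK A hA.
have [_ Phi0 _ _] := hPhi.
have uA : A \in unitmx by rewrite unitmxE hA unitr1.
have uAT : A^T \in unitmx by rewrite unitmx_tr.
have hS x : orlicz_projection_support Phi (mximage A K) x =
    orlicz_projection_support Phi K (invmx A *m x).
  exact: orlicz_projection_support_mximage.
rewrite /orlicz_projection_body; set S2 := [set P | _ /\ forall x, _ = orlicz_projection_support Phi K x].
set S1 := [set P | _].
have S21 P : S2 P -> S1 (mximage (invmx A^T) P).
  move=> [bP hP]; split; first by apply: convex_body_o_mximage; rewrite ?unitmx_inv.
  by move=> x; rewrite support_function_mximage hP hS trmx_inv trmxK.
have S12 P : S1 P -> S2 (mximage A^T P).
  move=> [bP hP]; split; first exact: convex_body_o_mximage.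
  by move=> x; rewrite support_function_mximage hP hS trmxK mulKmx.
have [[P S2P]|/forallNP noP] := pselect (exists P, S2 P).
  apply: xget_unique; first exact/S21/(xgetI _ S2P).
  move=> Q [[bQ _] hQ]; have [[bP _] hP] := S21 _ (xgetI set0 S2P).
  by apply: support_function_inj => // x; rewrite hQ hP.
(* If no body has the support function required for [K], none has the one for [AK]: both sides
   default to the empty set, which is its own image. *)
rewrite xgetPN; last by move=> P /S12; exact: noP.
by rewrite xgetPN//; apply/seteqP; split => // x [y []].
Qed.
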